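(* If $\{Y(u,n):u\in\mathcal U,\ n\in\mathbb N\}$ is a family of independent Hermitian Gaussian random matrices with variance matrices $V(u)=(v_{p,q}(u))$, then $$\lim_{n\to\infty}\tau_q(n)\big(T_{p_1,q_1}(u_1,n)\cdots T_{p_m,q_m}(u_m,n)\big)=\Psi_q\big(\widehat\omega_{p_1,q_1}(u_1)\cdots\widehat\omega_{p_m,q_m}(u_m)\big)$$ for any $m\in\mathbb N$, $u_1,\dots,u_m\in\mathcal U$ and $p_1,q_1,\dots,p_m,q_m,q\in[r]$, where the matricially free Gaussian operators $\omega_{p,q}(u)$ have variances $b_{p,q}(u)=d_pv_{p,q}(u)$.
   Context: Random matrices. Fix $r\in\mathbb N$, $[r]=\{1,\dots,r\}$, and a finite index set $\mathcal U$. For each $n$ let $[n]=\{1,\dots,n\}$ be partitioned into disjoint nonempty intervals $N_1,\dots,N_r$ (depending on $n$), $n_q=|N_q|$, with $\lim_{n\to\infty}n_q/n=d_q\ge 0$ for each $q$ (some $d_q$ may be $0$). $D_q$ is the $n\times n$ diagonal matrix with $(D_q)_{j,j}=1$ if $j\in N_q$ and all other entries $0$. $\tau_q(n)(A)=\frac1{n_q}\mathbb E\sum_{j\in N_q}A_{j,j}$. Symmetric blocks: $T_{q,q}(u,n)=D_qY(u,n)D_q$ and $T_{p,q}(u,n)=D_pY(u,n)D_q+D_qY(u,n)D_p$ for $p\ne q$. A family of independent Hermitian Gaussian random matrices (HGRM) is a family of Hermitian $n\times n$ random matrices $Y(u,n)=(Y_{i,j}(u,n))$ such that, for each $n$, the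 variables $\{\mathrm{Re}\,Y_{i,j}(u,n),\mathrm{Im}\,Y_{i,j}(u,n):1\le i\le j\le n,\ u\in\mathcal U\}$ are independent Gaussian with mean zero, $\mathbb E|Y_{j,j}(u,n)|^2=v_{q,q}(u)/n$ for $j\in N_q$, and $\mathbb E|\mathrm{Re}\,Y_{i,j}(u,n)|^2=\mathbb E|\mathrm{Im}\,Y_{i,j}(u,n)|^2=v_{p,q}(u)/2n$ for $(i,j)\in N_p\times N_q$ with $i\ne j$, where each $V(u)=(v_{p,q}(u))\in M_r(\mathbb R)$ is symmetric with positive entries. Operators. $\mathcal M$ is the Hilbert space with orthonormal basis consisting of vacuum vectors $\Omega_1,\dots,\Omega_r$ and all simple tensors $e_{p_1,p_2}(u_1)\otimes e_{p_2,p_3}(u_2)\otimes\cdots\otimes e_{p_m,q}(u_m)$ with $m\ge1$, $p_1,\dots,p_m,q\in[r]$, $u_1,\dots,u_m\in\mathcal U$. $\Psi_q(a)=\langle a\Omega_q,\Omega_q\rangle$. For nonnegative numbers $b_{p,q}(u)$ the matricially free creation operators $\wp_{p,q}(u)$ are given by $\wp_{p,q}(u)\Omega_q=\sqrt{b_{p,q}(u)}\,e_{p,q}(u)$, $\wp_{p,q}(u)(e_{q,s}(t)\otimes w)=\sqrt{b_{p,q}(u)}\,e_{p,q}(u)\otimes e_{q,s}(t)\otimes w$ for every basis vector $e_{q,s}(t)\otimes w$, and zero on all other basis vectors. The matricially free Gaussian operators of variance $b_{p,q}(u)$ are $\omega_{p,q}(u)=\wp_{p,q}(u)+\wp_{p,q}(u)^*$,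 and their symmetrizations are $\widehat\omega_{q,q}(u)=\omega_{q,q}(u)$, $\widehat\omega_{p,q}(u)=\omega_{p,q}(u)+\omega_{q,p}(u)$ for $p\ne q$. *)

(* Defs.v *)
From HB Require Import structures.
From mathcomp Require Import all_boot all_order all_algebra.
From mathcomp Require Import sesquilinear complex.
From mathcomp Require Import all_classical all_reals all_analysis.
Set Implicit Arguments.
Unset Strict Implicit.
Unset Printing Implicit Defensive.
Import Order.TTheory GRing.Theory Num.Theory.
Import numFieldNormedType.Exports.
Import ComplexField.Normc.
Local Open Scope classical_set_scope.
Local Open Scope ring_scope.
Local Open Scope complex_scope.

Section Probability.
Context (dO : measure_display) (Omega : measurableType dO) (R : realType)
  (P : probability Omega R).

(* [s] is the standard deviation; [s = 0] is the degenerate Gaussian (the law of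
   the imaginary part of a diagonal entry of a Hermitian matrix), which has to be
   singled out because [normal_prob 0 0] is not a Dirac mass. *)
Definition centered_gaussian (X : Omega -> R) : Prop :=
  measurable_fun setT X /\
  exists2 s : R, 0 <= s & forall A : set R, measurable A ->
    P (X @^-1` A) = if s == 0 then \d_(0 : R) A else normal_prob 0 s A.

Definition mutually_independent (I : finType) (X : I -> Omega -> R) : Prop :=
  forall (J : {set I}) (A : I -> set R), (forall i, measurable (A i)) ->
    P [set w | forall i, i \in J -> A i (X i w)] =
    (\prod_(i in J) P (X i @^-1` A i))%E.

Definition complex_expectation (Z : Omega -> R[i]) : R[i] :=
  fine ('E_P[fun w => complex.Re (Z w)]) +i*
  fine ('E_P[fun w => complex.Im (Z w)]).

End Probability.

Section Matrices.
Context (r : nat) (U : finType) (R : realType).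

Definition interval_partition (n : nat) (N : 'I_r -> {set 'I_n}) : Prop :=
  [/\ forall q, exists j, j \in N q,
      forall p q, p != q -> N p :&: N q = finset.set0,
      (\bigcup_(q : 'I_r) N q)%SET = [set: 'I_n]%SET
    & forall q (i j k : 'I_n), i \in N q -> k \in N q ->
        (i <= j <= k)%N -> j \in N q].

Definition block_diag (n : nat) (N : 'I_r -> {set 'I_n}) (q : 'I_r) :
    'M[R[i]]_n :=
  diag_mx (\row_j (j \in N q)%:R).

Definition symmetric_block (n : nat) (N : 'I_r -> {set 'I_n}) (p q : 'I_r)
    (Y : 'M[R[i]]_n) : 'M[R[i]]_n :=
  let D := block_diag N in
  if p == q then D q *m Y *m D q
  else D p *m Y *m D q + D q *m Y *m D p.

Context (dO : measure_display) (Omega : measurableType dO)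
  (P : probability Omega R).

Definition partial_trace (n : nat) (N : 'I_r -> {set 'I_n}) (q : 'I_r)
    (A : Omega -> 'M[R[i]]_n) : R[i] :=
  (#|N q|%:R)^-1 * complex_expectation P (fun w => \sum_(j in N q) A w j j).

Definition entry_index (n : nat) : finType :=
  {x : U * ('I_n * 'I_n) * bool | (x.1.2.1 <= x.1.2.2)%N}.

(* the boolean selects the real ([true]) or imaginary ([false]) part *)
Definition entry_part (n : nat) (Y : U -> Omega -> 'M[R[i]]_n)
    (x : entry_index n) (w : Omega) : R :=
  let: (u, (i, j), b) := val x in
  (if b then @complex.Re R else @complex.Im R) (Y u w i j).

Record HGRM (n : nat) (N : 'I_r -> {set 'I_n}) (V : U -> 'M[R]_r)
    (Y : U -> Omega -> 'M[R[i]]_n) : Prop := {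
  HGRM_hermitian : forall u w, Y u w \is hermsymmx;
  HGRM_gaussian : forall x, centered_gaussian P (entry_part Y x);
  HGRM_independent : mutually_independent P (entry_part Y);
  HGRM_var_diag : forall u q j, j \in N q ->
    ('E_P[fun w => (normc (Y u w j j) ^+ 2)%R])%E = (V u q q / n%:R)%:E;
  HGRM_var_Re : forall u p q i j, i \in N p -> j \in N q -> i != j ->
    ('E_P[fun w => (complex.Re (Y u w i j) ^+ 2)%R])%E =
    (V u p q / (2 * n%:R))%:E;
  HGRM_var_Im : forall u p q i j, i \in N p -> j \in N q -> i != j ->
    ('E_P[fun w => (complex.Im (Y u w i j) ^+ 2)%R])%E =
    (V u p q / (2 * n%:R))%:E
}.

End Matrices.

Section Operators.
Context (r : nat) (U : finType) (R : realType).

(* [([:: (p_1, u_1); ...; (p_m, u_m)], q)] indexes the simple tensor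
   e_{p_1,p_2}(u_1) ⊗ e_{p_2,p_3}(u_2) ⊗ ... ⊗ e_{p_m,q}(u_m), and [([::], q)]
   indexes the vacuum vector Omega_q: the inner indices of a simple tensor match,
   so each of them is recorded once. *)
Definition fock_index : Type := (seq ('I_r * U) * 'I_r)%type.

Definition vacuum (q : 'I_r) : fock_index := ([::], q).

(* the first matricial index: [q] for Omega_q and for e_{q,s}(t) ⊗ w *)
Definition left_index (x : fock_index) : 'I_r := head x.2 (unzip1 x.1).

(* when [left_index x = q], the index of e_{p,q}(u) ⊗ x, read as e_{p,q}(u) if
   x is Omega_q *)
Definition tensor_cons (p : 'I_r) (u : U) (x : fock_index) : fock_index :=
  ((p, u) :: x.1, x.2).

(* with [inner_product_norm], the complete normed space M is a Hilbert space *)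
Definition inner_product_norm (M : normedModType R[i])
    (ip : {dot M for Num.conj}) : Prop :=
  forall x : M, ip x x = `|x| ^+ 2.

Definition orthonormal_basis (M : normedModType R[i])
    (ip : {dot M for Num.conj}) (B : eqType) (e : B -> M) : Prop :=
  (forall x y, ip (e x) (e y) = (x == y)%:R) /\
  closure [set v : M | exists (s : seq B) (c : B -> R[i]),
             v = \sum_(x <- s) c x *: e x] = setT.

Definition is_adjoint (M : normedModType R[i]) (ip : {dot M for Num.conj})
    (a b : M -> M) : Prop :=
  forall x y, ip (a x) y = ip x (b y).

Definition is_creation (M : normedModType R[i]) (e : fock_index -> M)
    (b : R) (p q : 'I_r) (u : U) (a : {linear M -> M}) : Prop :=
  continuous a /\
  forall x, a (e x) =
    if left_index x == q then (Num.sqrt b)%:C *: e (tensor_cons p u x) else 0.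

Definition symmetrized (M : normedModType R[i])
    (omega : 'I_r -> 'I_r -> U -> M -> M) (p q : 'I_r) (u : U) (x : M) : M :=
  if p == q then omega q q u x else omega p q u x + omega q p u x.

Definition vacuum_state (M : normedModType R[i]) (ip : {dot M for Num.conj})
    (e : fock_index -> M) (q : 'I_r) (a : M -> M) : R[i] :=
  ip (a (e (vacuum q))) (e (vacuum q)).

End Operators.

(* Main.v *)
(** By Gaussian integration by parts, a product of normalized block traces of
    words in the [Y u] satisfies a loop equation: contracting the first letter
    of a word with a letter of the same word splits that word into two shorter
    ones, and contracting it with a letter of another trace merges the two words
    at the cost of a factor at most [V u p q / n].  By induction on the total
    length, every mixed moment of traces converges to the product of the numbers
    determined by the recursion without merging terms.  The vacuum moments of
    the operators satisfy the same recursion: each created tensor leg has to be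
    annihilated later, and cutting a word at that annihilation splits it in the
    same way.  Started in a given block, a product of symmetric blocks visits a
    determined sequence of blocks, so only one path of blocks contributes, on
    either side. *)

(* The loop equation does not close on single traces: its splitting term is the expectation of a
   product of two traces. Carrying arbitrary products through the induction avoids a separate
   variance estimate; factorization in the limit comes out of the vanishing of the merging terms.
   Each trace is normalized by the size of its own block, so a split leaves the unnormalized sum
   over the block $p$ and hence the factor $|N_p|/n \to d_p$, which is the origin of $b_{p,q} = d_p
   v_{p,q}$. If $d_q = 0$, then $|N_q|$ may stay bounded, and the merging factor $v/(n|N_q|)$ is
   controlled by $|N_q| \ge 1$ alone. Only polynomials in the real and imaginary parts of the
   entries occur, so integration by parts becomes algebra on lists of monomials, once moments factor
   over independent variables and each variable obeys the Gaussian moment recursion. On the operator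
   side, letters are moved one at a time onto basis vectors, where the adjoints are explicit. *)
Require Import Defs.
From HB Require Import structures.
From mathcomp Require Import all_boot all_order all_algebra.
From mathcomp Require Import sesquilinear complex.
From mathcomp Require Import all_classical all_reals all_analysis.
From mathcomp Require Import measurable_realfun zify ring lra.
Import Order.TTheory GRing.Theory Num.Theory.
Import numFieldNormedType.Exports.
Local Open Scope classical_set_scope.
Local Open Scope ring_scope.
Local Open Scope complex_scope.

Set Implicit Arguments.
Unset Strict Implicit.
Unset Printing Implicit Defensive.

(** * Integration against an image measure *)

Section Transfer.
Context d d' (T : measurableType d) (T' : measurableType d') (R : realType).
Variables (mu : {measure set T -> \bar R}) (nu : {measure set T' -> \bar R}).
Variables (X : T -> T') (h : T -> R).
Hypotheses (mX : measurable_fun setT X) (mh : measurable_fun setT h)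
  (h0 : forall x, 0 <= h x)
  (hX : forall A, measurable A ->
    (\int[mu]_x (h x * \1_A (X x))%:E = nu A)%E).
Local Open Scope ereal_scope.
Import HBNNSimple.

(** The weight [h] lets one statement serve three purposes: passing from a density to [normal_prob]
    ([X] the identity), from a random variable to its law ([h = 1]), and integrating one independent
    factor against the product of the others. *)
Let transfer_nnsfun (g : {nnsfun T' >-> R}) :
  \int[mu]_x (h x * g (X x))%:E = \int[nu]_y (g y)%:E.
Proof.
have gE y : (g y)%:E = \sum_(c \in range g) (c * \1_(g @^-1` [set c]) y)%:E.
  by rewrite fsumEFin// -(fimfunE g y).
have mg c : measurable (g @^-1` [set c]) by exact: measurable_funPTI.
have m1X c : measurable_fun setT (fun x => \1_(g @^-1` [set c]) (X x) : R).
  by apply: measurableT_comp => //; exact: measurable_indic.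
have c0 c : c \in range g -> (0 <= c)%R by rewrite inE => -[t _ <-].
under [RHS]eq_integral do rewrite gE.
rewrite ge0_integral_fsum//; first last.
- by move=> c y _; exact: nnfun_muleindic_ge0.
- by move=> c; apply/measurable_EFinP; exact: measurable_funM.
transitivity (\int[mu]_x (\sum_(c \in range g)
    (h x)%:E * (c * \1_(g @^-1` [set c]) (X x))%:E)).
  apply: eq_integral => x _; rewrite EFinM gE ge0_mule_fsumr// => c.
  exact: nnfun_muleindic_ge0.
rewrite ge0_integral_fsum//; first last.
- move=> c x _; apply: mule_ge0; first by rewrite lee_fin.
  exact: nnfun_muleindic_ge0.
- move=> c; apply: emeasurable_funM; apply/measurable_EFinP => //.
  exact: measurable_funM.
apply: eq_fsbigr => c cg.
rewrite [RHS](_ : _ = c%:E * nu (g @^-1` [set c])); last first.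
  under eq_integral do rewrite EFinM.
  rewrite ge0_integralZl ?lee_fin ?c0//;
    first by rewrite integral_indic// setIT.
  by apply/measurable_EFinP; exact: measurable_indic.
rewrite -hX// -ge0_integralZl ?lee_fin ?c0//; first last.
- by move=> x _; rewrite lee_fin mulr_ge0.
- by apply/measurable_EFinP; exact: measurable_funM.
by apply: eq_integral => x _; rewrite -!EFinM mulrCA.
Qed.

Lemma ge0_integral_transfer (f : T' -> R) :
  measurable_fun setT f -> (forall y, (0 <= f y)%R) ->
  \int[mu]_x (h x * f (X x))%:E = \int[nu]_y (f y)%:E.
Proof.
move=> mf f0.
have mfE : measurable_fun setT (EFin \o f) by apply/measurable_EFinP.
pose g := nnsfun_approx measurableT mfE.
have f0E y : setT y -> 0 <= (EFin \o f) y by rewrite lee_fin.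
have mg n : measurable_fun setT (g n : T' -> R) by exact/measurable_funP.
have -> : \int[nu]_y (f y)%:E = lim (\int[nu]_y (EFin \o g n) y @[n --> \oo]).
  rewrite -monotone_convergence//.
  - apply: eq_integral => y _; apply/esym/cvg_lim => //.
    exact: (cvg_nnsfun_approx measurableT mfE f0E).
  - by move=> n; apply/measurable_EFinP.
  - by move=> n y _ /=; rewrite lee_fin.
  - move=> y _ a b ab; rewrite lee_fin.
    exact/lefP/(nd_nnsfun_approx measurableT mfE ab).
have -> : \int[mu]_x (h x * f (X x))%:E =
    lim (\int[mu]_x (h x * g n (X x))%:E @[n --> \oo]).
  rewrite -monotone_convergence//.
  - apply: eq_integral => x _; apply/esym/cvg_lim => //.
    under eq_fun do rewrite EFinM; rewrite EFinM.
    apply: cvgeZl => //.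
    exact: (cvg_nnsfun_approx measurableT mfE f0E).
  - move=> n; apply/measurable_EFinP; apply: measurable_funM => //.
    exact: measurableT_comp.
  - by move=> n y _ /=; rewrite lee_fin mulr_ge0.
  - move=> y _ a b ab; rewrite lee_fin ler_wpM2l//.
    exact/lefP/(nd_nnsfun_approx measurableT mfE ab).
by under eq_fun do rewrite transfer_nnsfun.
Qed.

Lemma integral_transfer (f : T' -> R) : measurable_fun setT f ->
  \int[mu]_x (h x * f (X x))%:E = \int[nu]_y (f y)%:E.
Proof.
move=> mf; rewrite integralE [RHS]integralE; congr (_ - _).
- transitivity (\int[mu]_x (h x * (f^\+)%R (X x))%:E).
    apply: eq_integral => x _; rewrite funeposE /funrpos/= -EFin_max.
    by congr EFin; rewrite maxr_pMr// mulr0.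
  rewrite ge0_integral_transfer//; last exact: measurable_funrpos.
  by apply: eq_integral => y _; rewrite funeposE /funrpos/= -EFin_max.
- transitivity (\int[mu]_x (h x * (f^\-)%R (X x))%:E).
    apply: eq_integral => x _; rewrite funenegE /funrneg/= -EFin_max.
    by congr EFin; rewrite maxr_pMr// mulr0 mulrN.
  rewrite ge0_integral_transfer//; last exact: measurable_funrneg.
  by apply: eq_integral => y _; rewrite funenegE /funrneg/= -EFin_max.
Qed.

Lemma integrable_transfer (f : T' -> R) : measurable_fun setT f ->
  mu.-integrable setT (fun x => (h x * f (X x))%:E) <->
  nu.-integrable setT (EFin \o f).
Proof.
move=> mf.
have abs : \int[mu]_x `|(h x * f (X x))%:E| = \int[nu]_y `|(f y)%:E|.
  rewrite -[RHS](@ge0_integral_transfer (fun y => `|f y|%R))//; last first.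
    exact: measurableT_comp.
  by apply: eq_integral => x _; rewrite abse_EFin normrM (ger0_norm (h0 x)).
split=> /integrableP[_ i]; apply/integrableP; split.
- exact/measurable_EFinP.
- by rewrite /= -abs.
- apply/measurable_EFinP; apply: measurable_funM => //.
  exact: measurableT_comp.
- by rewrite abs.
Qed.

End Transfer.

(** * Moments of the Gaussian law *)

Section GaussianMoments.
Context (R : realType) (s : R) (s0 : 0 < s).
Local Notation mu := (@lebesgue_measure R).
Local Notation phi := (normal_pdf 0 s).
Implicit Types (x : R) (k : nat).

Lemma centered_pdfE (t : R) x : 0 < t ->
  normal_pdf 0 t x = normal_peak t * expR (- (x ^+ 2 / (t ^+ 2 *+ 2))).
Proof. by move=> t0; rewrite normal_pdfE ?gt_eqF// /normal_fun subr0 mulNr. Qed.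

(** For [k > 0], raise $t/k \le e^{t/k}$ to the power $k$. *)
Lemma expr_le_expR k (t : R) : 0 <= t -> t ^+ k <= k%:R ^+ k * expR t.
Proof.
case: k => [|k] t0; first by rewrite !expr0 mul1r -expR0 ler_expR.
have tk : t = k.+1%:R * (t / k.+1%:R) by rewrite mulrC divfK.
rewrite [in leRHS]tk expRM_natl -exprMn [in leLHS]tk.
rewrite lerXn2r ?nnegrE ?mulr_ge0 ?invr_ge0 ?expR_ge0// ler_pM2l//.
by rewrite (le_trans _ (expR_ge1Dx _))// lerDr.
Qed.

(* [|x ^+ k| <= 1 + x ^+ (2 * k)], and both terms are at most a multiple of
   [expR (x ^+ 2 / (4 * s ^+ 2))], which turns the density of variance [s ^+ 2]
   into one of variance [2 * s ^+ 2]. *)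
Lemma monomial_pdf_le k : exists2 C, 0 <= C &
  forall x, `|x ^+ k * phi x| <= C * normal_pdf 0 (s * Num.sqrt 2) x.
Proof.
have r2 : 0 < Num.sqrt 2 :> R by rewrite sqrtr_gt0.
have t0 : 0 < s * Num.sqrt 2 by rewrite mulr_gt0.
have s2 : 0 < s ^+ 2 by rewrite exprn_gt0.
(* With $y = x^2/(4s^2)$, the term $x^{2k} = (4s^2)^k y^k$ is bounded through [expr_le_expR] at $y$,
   and the summand 1 through $1 \le e^y$. The ratio of peaks in the witness exchanges the two
   normalizations. *)
pose B : R := 1 + (4 * s ^+ 2) ^+ k * k%:R ^+ k.
have B0 : 0 <= B by rewrite addr_ge0// mulr_ge0// exprn_ge0// mulr_ge0// ltW.
exists (B * normal_peak s / normal_peak (s * Num.sqrt 2)).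
  by rewrite divr_ge0 ?mulr_ge0 ?normal_peak_ge0.
move=> x; rewrite !centered_pdfE// [leRHS]mulrA divfK ?gt_eqF ?normal_peak_gt0
  ?gt_eqF//.
rewrite exprMn sqr_sqrtr//.
set y := x ^+ 2 / (4 * s ^+ 2).
have -> : x ^+ 2 / (s ^+ 2 *+ 2) = y + y by rewrite /y; field; rewrite gt_eqF.
have -> : x ^+ 2 / (s ^+ 2 * 2 *+ 2) = y by rewrite /y; field; rewrite gt_eqF.
have y0 : 0 <= y by rewrite divr_ge0 ?sqr_ge0// mulr_ge0// ltW.
rewrite normrM [`|normal_peak s * _|]ger0_norm ?mulr_ge0 ?normal_peak_ge0
  ?expR_ge0//.
rewrite mulrCA -[leRHS]mulrA [leRHS]mulrCA ler_pM2l ?normal_peak_gt0 ?gt_eqF//.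
rewrite opprD expRD mulrA ler_pM2r ?expR_gt0//.
rewrite -ler_pdivlMr ?expR_gt0// -expRN opprK normrX.
apply: (@le_trans _ _ (1 + x ^+ 2 ^+ k)).
  rewrite -exprM mulnC exprM -normrX -[x ^+ k ^+ 2]real_normK ?num_real//.
  by have := sqr_ge0 (`|x ^+ k| - 1); have := normr_ge0 (x ^+ k); nra.
have -> : x ^+ 2 = 4 * s ^+ 2 * y by rewrite /y; field; rewrite gt_eqF.
rewrite /B exprMn [leRHS]mulrDl mul1r lerD//; first by rewrite -expR0 ler_expR.
by rewrite -[leRHS]mulrA ler_wpM2l ?expr_le_expR// exprn_ge0// mulr_ge0//
  (ltW s2).
Qed.

Lemma measurable_monomial_pdf k : measurable_fun setT (fun x => x ^+ k * phi x).
Proof. by apply: measurable_funM;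
  [exact: measurable_funX|exact: measurable_normal_pdf]. Qed.

Lemma integrable_monomial_pdf k :
  mu.-integrable setT (EFin \o (fun x => x ^+ k * phi x)).
Proof.
have [C C0 hC] := monomial_pdf_le k.
apply: (@le_integrable _ _ _ mu _ measurableT _
  (EFin \o (fun x => C * normal_pdf 0 (s * Num.sqrt 2) x))).
- by apply/measurable_EFinP; exact: measurable_monomial_pdf.
- move=> x _ /=; rewrite lee_fin (le_trans (hC x))// ler_norm//.
- apply: eq_integrable (integrableZl measurableT C
  (integrable_normal_pdf 0 (s * Num.sqrt 2))) => //.
Qed.

(** The bound at the next exponent [k.+1], divided by $|a_n| \ge n$, gives decay of order $1/n$; the
    shift of the sequence avoids $n = 0$. *)
Lemma monomial_pdf_cvg0 k (a : nat -> R) : (forall n, n%:R <= `|a n|) ->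
  (a n ^+ k * phi (a n)) @[n --> \oo] --> 0.
Proof.
move=> ha; have [C C0 hC] := monomial_pdf_le k.+1.
have t0 : s * Num.sqrt 2 != 0 by rewrite mulf_neq0 ?gt_eqF ?sqrtr_gt0.
pose B := C * normal_peak (s * Num.sqrt 2).
rewrite -cvg_shiftS/=.
apply/norm_cvg0P; apply:
  (@squeeze_cvgr _ _ _ _ (fun=> 0) (fun n => B * n.+1%:R^-1)).
- near=> n; rewrite normr_ge0/= ler_pdivlMr ?ltr0Sn// mulrC.
  apply: le_trans (le_trans (hC (a n.+1)) _).
    by rewrite exprS -mulrA [leRHS]normrM ler_wpM2r.
  by rewrite ler_wpM2l// normal_pdf_ub.
- exact: cvg_cst.
- by rewrite -[X in _ --> X](mulr0 B); apply: cvgMr; exact: cvg_harmonic.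
Unshelve. all: by end_near. Qed.

Lemma is_derive_monomial_pdf k x :
  is_derive x 1 (fun y => y ^+ k * phi y)
   (k%:R * (x ^+ k.-1 * phi x) - (x ^+ k.+1 * phi x) / s ^+ 2).
Proof.
have -> : (fun y => y ^+ k * phi y) =
  (fun y => y ^+ k * (normal_peak s * expR (- (y ^+ 2 / (s ^+ 2 *+ 2))))).
  by apply/funext => y; rewrite centered_pdfE.
have H1 : is_derive x 1 (fun y : R => - (y ^+ 2 / (s ^+ 2 *+ 2)))
  (- (x / s ^+ 2)).
  apply: is_derive_eq.
  by rewrite /GRing.scale/=; field; rewrite gt_eqF.
have H2 := is_derive1_comp (is_derive_expR _) H1.
have H3 := is_deriveM (is_deriveX k (is_derive_id x (1 : R)))
  (is_deriveZ (normal_peak s) H2).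
apply: is_derive_eq.
  have <- : (id ^+ k * (normal_peak s \*:
      (expR \o (fun y : R => - (y ^+ 2 / (s ^+ 2 *+ 2)))))) =
    (fun y => y ^+ k * (normal_peak s * expR (- (y ^+ 2 / (s ^+ 2 *+ 2))))).
    by apply/funext => y; rewrite !fctE.
  exact: H3.
rewrite !centered_pdfE// !fctE /GRing.scale/=.
move: (expR _) => E; rewrite [x ^+ k.+1]exprS -[_ *: E]/(_ * E).
 ring.
Qed.

Lemma continuous_monomial_pdf k : continuous (fun x => x ^+ k * phi x).
Proof.
move=> x; apply: differentiable_continuous; apply/derivable1_diffP.
by have [] := is_derive_monomial_pdf k x.
Qed.

Lemma integrable_cvg_symitv (f : R -> R) : mu.-integrable setT (EFin \o f) ->
  (\int[mu]_(x in `[(- n%:R)%R, n%:R%R]) (f x)%:E)%E @[n --> \oo] -->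
  (\int[mu]_x (f x)%:E)%E.
Proof.
move=> intf.
have mf : measurable_fun setT f by apply/measurable_EFinP;
  apply: measurable_int intf.
pose g (n : nat) x := (f x * \1_(`[- n%:R, n%:R]) x)%:E.
have -> : (fun n : nat => \int[mu]_(x in `[(- n%:R)%R, n%:R%R]) (f x)%:E)%E =
  (fun n : nat => \int[mu]_x (g n x))%E.
  apply/funext => n; rewrite integral_mkcond; apply: eq_integral => x _.
  by rewrite epatch_indic /g EFinM.
have absf : mu.-integrable setT (fun x => `|f x|%:E).
  by apply: eq_integrable (integrable_abse intf).
have mg n : measurable_fun setT (g n).
  by apply/measurable_EFinP; apply: measurable_funM.
have gf : {ae mu, forall x, setT x -> g ^~ x @ \oo --> (EFin \o f) x}.
  apply: aeW => x _; apply: cvg_near_cst; near=> n.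
  rewrite /g indicE mem_set ?mulr1//= in_itv/= -ler_norml.
  by near: n; exact: nbhs_infty_ger.
have gb : {ae mu, forall x n, setT x -> (`|g n x| <= `|f x|%:E)%E}.
  apply: aeW => x n _; rewrite /g lee_fin normrM ler_piMr// indicE.
  by case: (_ \in _); rewrite ?normr1 ?normr0.
have [] := @dominated_convergence _ _ _ mu setT measurableT g (EFin \o f)
  (fun x => `|f x|%:E) mg _ gf absf gb => //.
by apply/measurable_EFinP.
Unshelve. all: by end_near. Qed.

(** Integrate the derivative of $x^k\varphi(x)$ over growing symmetric segments: the boundary terms
    vanish in the limit, so the two terms of the derivative have equal integrals. At [k = 0] the
    truncated [k.-1] is multiplied by 0. *)
Lemma integral_monomial_pdf k :
  (\int[mu]_x (x ^+ k.+1 * phi x)%:E =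
   (k%:R * s ^+ 2)%:E * \int[mu]_x (x ^+ k.-1 * phi x)%:E)%E.
Proof.
pose F x := x ^+ k * phi x.
pose G x := k%:R * (x ^+ k.-1 * phi x) - (x ^+ k.+1 * phi x) / s ^+ 2.
have i1 := integrable_monomial_pdf k.-1.
have i2 := integrable_monomial_pdf k.+1.
have j1 : mu.-integrable setT (fun x => k%:R%:E * (x ^+ k.-1 * phi x)%:E)%E.
  exact: integrableZl.
have j2 : mu.-integrable setT
  (fun x => (x ^+ k.+1 * phi x)%:E * ((s ^+ 2)^-1)%:E)%E.
  exact: integrableZr.
have iG : mu.-integrable setT (EFin \o G).
  by apply: eq_integrable (integrableB measurableT j1 j2).
have F0 : F n%:R - F (- n%:R) @[n --> \oo] --> 0.
  rewrite -[X in _ --> X](subr0 0); apply: cvgB; apply: monomial_pdf_cvg0 => n.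
    by rewrite ger0_norm.
  by rewrite normrN ger0_norm.
have cG : continuous G.
  move=> x; apply: cvgB.
    by apply: cvgM; [exact: cvg_cst|exact: continuous_monomial_pdf].
  by apply: cvgM; [exact: continuous_monomial_pdf|exact: cvg_cst].
have dF x : derivable F x 1 by have [] := is_derive_monomial_pdf k x.
have cF : continuous F by exact: continuous_monomial_pdf.
have FG x : derive1 F x = G x.
  by rewrite derive1E; have [_ ->] := is_derive_monomial_pdf k x.
(* The successor keeps the segment nondegenerate. *)
have FTC n : (\int[mu]_(x in `[(- n.+1%:R)%R, n.+1%:R%R]) (G x)%:E)%E =
    (F n.+1%:R - F (- n.+1%:R))%:E.
  rewrite (continuous_FTC2 (F := F)) ?EFinB//.
  - by rewrite gtrN.
  - exact: continuous_subspaceT.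
  - split => //.
    + exact/cvg_at_right_filter/cF.
    + exact/cvg_at_left_filter/cF.
have intG0 : (\int[mu]_x (G x)%:E)%E = 0%E.
  have := integrable_cvg_symitv iG; rewrite -cvg_shiftS.
  under eq_fun do rewrite FTC.
  move=> /cvg_lim <- //; apply/cvg_lim => //; apply: cvg_EFin;
    first by near=> n.
  by move: F0; rewrite -cvg_shiftS.
have := intG0; rewrite (_ : (fun x => _) =
  (fun x => k%:R%:E * (x ^+ k.-1 * phi x)%:E - (x ^+ k.+1 * phi x)%:E *
  ((s ^+ 2)^-1)%:E)%E) //.
rewrite integralB// integralZl// integralZr//.
have /fineK <- := integrable_fin_num measurableT i1.
have /fineK <- := integrable_fin_num measurableT i2.
rewrite -!EFinM -EFinB => -[] /eqP; rewrite subr_eq0 => /eqP.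
set a := fine _; set b := fine _ => ab; congr EFin.
rewrite mulrAC ab divfK// gt_eqF// exprn_gt0//.
Unshelve. all: by end_near. Qed.

End GaussianMoments.

Section GaussianLaw.
Context (dO : measure_display) (Omega : measurableType dO) (R : realType)
  (P : probability Omega R).
Local Open Scope ereal_scope.

Lemma integral_law (X : Omega -> R) (A : set R) :
  measurable_fun setT X -> measurable A ->
  \int[P]_w (1 * \1_A (X w))%:E = P (X @^-1` A).
Proof.
move=> mX mA; under eq_integral do rewrite mul1r.
transitivity (\int[P]_w (\1_(X @^-1` A) w : R)%:E); first exact: eq_integral.
by rewrite integral_indic ?setIT// -[_ @^-1` _]setTI; exact: mX.
Qed.

Lemma normal_prob_moment (s : R) (k : nat) : (0 < s)%R ->
  (normal_prob 0 s).-integrable setT (EFin \o (fun x : R => x ^+ k)%R) /\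
  \int[normal_prob 0 s]_x (x ^+ k)%:E =
  \int[@lebesgue_measure R]_x (x ^+ k * normal_pdf 0 s x)%:E.
Proof.
move=> s0.
pose nu : {measure set (measurableTypeR R) -> \bar R} := normal_prob 0 s.
have law (A : set R) : measurable A ->
    \int[@lebesgue_measure R]_x (normal_pdf 0 s x * \1_A (idfun x))%:E =
    nu A.
  move=> mA; rewrite [RHS]integral_mkcond; apply: eq_integral => x _.
  by rewrite epatch_indic EFinM.
have mk : measurable_fun setT (fun x : R => x ^+ k)%R by exact: measurable_funX.
have mid : measurable_fun [set: R] idfun by exact: measurable_id.
split.
  apply: (integrable_transfer (T := measurableTypeR R) (T' := measurableTypeR R)
    (mu := lebesgue_measure) (nu := nu) mid (measurable_normal_pdf 0 s)
    (normal_pdf_ge0 0 s) law mk).1.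
  apply: eq_integrable (integrable_monomial_pdf s0 k) => // x _.
  by rewrite /= mulrC.
rewrite -(integral_transfer (T := measurableTypeR R) (T' := measurableTypeR R)
    (mu := lebesgue_measure) (nu := nu) mid (measurable_normal_pdf 0 s)
    (normal_pdf_ge0 0 s) law mk).
by apply: eq_integral => x _; rewrite mulrC.
Qed.

(** The recursion is phrased with the second moment so that it covers the Dirac mass as well;
    diagonal imaginary parts then need no special treatment in Wick's formula. *)
Lemma centered_gaussian_moments (X : Omega -> R) : centered_gaussian P X ->
  (forall k, P.-integrable setT (fun w => (X w ^+ k)%:E)) /\
  (forall k, \int[P]_w (X w ^+ k.+1)%:E =
    (k%:R)%:E * \int[P]_w (X w ^+ 2)%:E * \int[P]_w (X w ^+ k.-1)%:E).
Proof.
move=> [mX [s s0 lawX]].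
(* Any constant [v] will do: the case [k = 1] identifies it with the second moment. *)
suff [i [v e]] : (forall k, P.-integrable setT (fun w => (X w ^+ k)%:E)) /\
    exists v : R, forall k, \int[P]_w (X w ^+ k.+1)%:E =
      (k%:R * v)%:E * \int[P]_w (X w ^+ k.-1)%:E.
  split=> // k; rewrite e EFinM (e 1%N) /= mul1r -muleA.
  under [in RHS]eq_integral do rewrite expr0.
  have -> : \int[P]__ (1 : R)%:E = 1.
    by rewrite integral_cst// mul1e; exact: probability_setT.
  by rewrite mule1 muleA.
have mk k : measurable_fun setT (fun x : R => x ^+ k)%R by exact:
  measurable_funX.
have m1 : measurable_fun [set: Omega] (fun=> 1 : R)%R by exact: measurable_cst.
have p1 : forall w : Omega, (0 <= (fun=> 1 : R) w)%R by [].
have [s00|sn0] := eqVneq s 0%R.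
  have law (A : set R) : measurable A ->
      \int[P]_w (1 * \1_A (X w))%:E = \d_(0%R : R) A.
    by move=> mA; rewrite integral_law// lawX// s00 eqxx.
  have X0 k : \int[P]_w (X w ^+ k)%:E = (0 ^+ k)%:E.
    transitivity (\int[P]_w (1 * X w ^+ k)%:E).
      by apply: eq_integral => w _; rewrite mul1r.
    rewrite (integral_transfer mX m1 p1 law (mk k)).
    rewrite integral_dirac//; last by apply/measurable_EFinP.
    by rewrite -[RHS]mul1e; congr (_ * _); exact: diracT.
  split=> [k|].
    apply: eq_integrable ((integrable_transfer mX m1 p1 law (mk k)).2 _) => //.
      by move=> w _; rewrite mul1r.
    apply/integrableP; split; first exact/measurable_EFinP.
    rewrite integral_dirac//; last first.
      by apply: measurableT_comp => //; exact/measurable_EFinP.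
    rewrite (_ : \d_ _ _ = 1); last exact: diracT.
    by rewrite mul1e ltry.
  by exists 0%R => k; rewrite X0 expr0n mulr0 mul0e.
have {sn0}s0 : (0 < s)%R by rewrite lt_neqAle eq_sym sn0.
pose nu : {measure set (measurableTypeR R) -> \bar R} := normal_prob 0 s.
have law (A : set R) : measurable A ->
    \int[P]_w (1 * \1_A (X w))%:E = nu A.
  by move=> mA; rewrite integral_law//; apply: eq_trans (lawX A mA) _;
    rewrite// gt_eqF.
have Xk k : \int[P]_w (X w ^+ k)%:E =
    \int[@lebesgue_measure R]_x (x ^+ k * normal_pdf 0 s x)%:E.
  transitivity (\int[P]_w (1 * X w ^+ k)%:E).
    by apply: eq_integral => w _; rewrite mul1r.
  rewrite (integral_transfer (T' := measurableTypeR R) (nu := nu) mX m1 p1 law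
    (mk k)).
  exact: (normal_prob_moment k s0).2.
split=> [k|].
  apply: eq_integrable ((integrable_transfer (T' := measurableTypeR R)
    (nu := nu) mX m1 p1 law (mk k)).2 _) => //.
    by move=> w _; rewrite mul1r.
  exact: (normal_prob_moment k s0).1.
by exists (s ^+ 2)%R => k; rewrite !Xk integral_monomial_pdf.
Qed.

End GaussianLaw.

(** * Factorization of expectations of independent variables *)

Section Independence.
Context (dO : measure_display) (Omega : measurableType dO) (R : realType)
  (P : probability Omega R) (I : finType) (X : I -> Omega -> R).
Hypotheses (mX : forall i, measurable_fun setT (X i))
  (indX : mutually_independent P X).
Implicit Types f : I -> R -> R.

Let good f := forall i, measurable_fun setT (f i) /\
  P.-integrable setT (fun w => (f i (X i w))%:E).

Let mean f i : R := fine (\int[P]_w (f i (X i w))%:E)%E.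

Let update f k (g : R -> R) : I -> R -> R := fun i => if i == k then g else f i.

Let measurable_prodf f (S : {pred I}) : (forall i, measurable_fun setT (f i)) ->
  measurable_fun setT (fun w => \prod_(i in S) f i (X i w)).
Proof.
move=> mf; rewrite (_ : (fun _ => _) =
    (fun w => \prod_(i <- enum S) f i (X i w))).
  by apply: measurable_prod => i _; exact: measurableT_comp.
by apply/funext => w; rewrite big_enum.
Qed.

Let mean_indic i (A : set R) : measurable A ->
  (\int[P]_w (\1_A (X i w) : R)%:E)%E = P (X i @^-1` A).
Proof.
move=> mA; rewrite -(integral_law P (mX i) mA).
by apply: eq_integral => w _; rewrite mul1r.
Qed.

Let meanK f : good f -> forall i,
  (\int[P]_w (f i (X i w))%:E)%E = (mean f i)%:E.
Proof.
by move=> gf i; rewrite fineK//; apply: integrable_fin_num (gf i).2.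
Qed.

Let prodE f g k w : \prod_i update f k g i (X i w) =
  g (X k w) * \prod_(i | i != k) f i (X i w).
Proof.
rewrite (bigD1 k)//= {1}/update eqxx; congr (_ * _).
by apply: eq_bigr => i /negPf ik; rewrite /update ik.
Qed.

Let good_indic f k (A : set R) : measurable A -> good f -> good
  (update f k \1_A).
Proof.
move=> mA gf i; rewrite /update; case: eqP => [->|_]; last exact: gf.
split; first exact: measurable_indic.
apply/integrableP; split.
  by apply/measurable_EFinP; apply: measurableT_comp => //;
    exact: measurable_indic.
rewrite (eq_integral (fun w => (\1_A (X k w))%:E)); last first.
  by move=> w _; rewrite abse_EFin ger0_norm.
rewrite mean_indic//; apply: le_lt_trans (ltry 1).
apply: probability_le1; rewrite -[_ @^-1` _]setTI; exact: mX.
Qed.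

Let mean_update f g k i : i != k -> mean (update f k g) i = mean f i.
Proof. by move=> /negPf ik; rewrite /mean /update ik. Qed.

(* Outside [K] the factors are indicators; enlarging [K] by one index at a time,
   the factor at that index is integrated by [integral_transfer] against the law
   of the corresponding variable. *)
Let indep_ge0 (K : seq I) : forall f, good f -> (forall i x, 0 <= f i x) ->
  (forall i, i \notin K -> exists2 A, measurable A & f i = \1_A) ->
  (\int[P]_w (\prod_i f i (X i w))%:E)%E = (\prod_i mean f i)%:E.
Proof.
elim: K => [|k K IH] f gf f0 fK.
  have {}fK i : exists A, measurable A /\ f i = \1_A.
    by have [//|A mA ->] := fK i; exists A.
  have [A hA] := choice fK.
  have mA i : measurable (A i) by have [] := hA i.
  have fA i : f i = \1_(A i) by have [] := hA i.
  pose S := [set w | forall i, i \in [set: I]%SET -> A i (X i w)].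
  have mS : measurable S.
    rewrite (_ : S = \bigcap_(i in setT) (X i @^-1` A i)).
      apply: fin_bigcap_measurable => // i _.
      by rewrite -[_ @^-1` _]setTI; exact: mX.
    by apply/seteqP; split=> w hw i; [move=> _; apply: hw|move=> _; exact: hw].
  transitivity (P S).
    rewrite -(setIT S) -integral_indic//; apply: eq_integral => w _.
    congr EFin; rewrite indicE; case: (boolP (w \in S)) => /= [/set_mem wS|wS].
      by rewrite big1// => i _; rewrite fA indicE mem_set//; apply: wS.
    have [i nAi] : exists i, ~ A i (X i w).
      apply: contrapT => h; move/negP: wS; apply; apply/mem_set => i _.
      by apply: contrapT => ?; apply: h; exists i.
    by rewrite (bigD1 i)//= fA indicE memNset// mul0r.
  rewrite indX//; rewrite [LHS](eq_bigl xpredT); last by move=> i;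
    rewrite finset.in_setT.
  elim/big_rec2: _ => // i x y _ ->.
  by rewrite EFinM -meanK// fA mean_indic.
pose c := \prod_(i | i != k) mean f i.
pose H w := \prod_(i | i != k) f i (X i w).
have mH : measurable_fun setT H by apply: measurable_prodf => i;
  exact: (gf i).1.
have H0 w : 0 <= H w by apply: prodr_ge0.
have mean0 i : 0 <= mean f i.
  by apply: fine_ge0; apply: integral_ge0 => w _; rewrite lee_fin.
have c0 : 0 <= c by apply: prodr_ge0.
(* The induction hypothesis, applied with an indicator at [k], says that the image under [X k] of
   [P] weighted by [H] is [c] times the law of [X k]. *)
pose Xk : {mfun Omega >-> R} := mfun_Sub (mem_set (mX k)).
pose nu : {measure set R -> \bar R} := mscale (NngNum c0) (distribution P Xk).
have law (A : set R) : measurable A ->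
    (\int[P]_w (H w * \1_A (X k w))%:E)%E = nu A.
  move=> mA; have gA := good_indic k mA gf.
  have A0 i x : 0 <= update f k \1_A i x by rewrite /update; case: eqP.
  have := IH _ gA A0.
  under eq_integral do rewrite prodE mulrC.
  move=> -> => [|i iK].
    rewrite (bigD1 k)//= mulrC EFinM; congr (_ * _)%E.
      by congr EFin; apply: eq_bigr => i ik; exact: mean_update.
    by rewrite -meanK// /update eqxx mean_indic.
  rewrite /update; case: eqP => [_|/eqP ik]; first by exists A.
  by apply: fK; rewrite inE negb_or ik.
transitivity (\int[P]_w (H w * f k (X k w))%:E)%E.
  by apply: eq_integral => w _; rewrite (bigD1 k)//= mulrC.
rewrite (integral_transfer (mX k) mH H0 law (gf k).1).
rewrite ge0_integral_mscale//; last 2 first.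
- by apply/measurable_EFinP; exact: (gf k).1.
- by move=> x _; rewrite lee_fin.
rewrite ge0_integral_distribution//; last 2 first.
- by apply/measurable_EFinP; exact: (gf k).1.
- by move=> x; rewrite lee_fin.
by rewrite [X in (_ * X)%E]meanK// -EFinM mulrC [in RHS](bigD1 k).
Qed.

(* [K] contains the indices whose factors may change sign. *)
Let independent_prod (K : seq I) : forall f, good f ->
  (forall i, i \notin K -> forall x, 0 <= f i x) ->
  P.-integrable setT (fun w => (\prod_i f i (X i w))%:E) /\
  (\int[P]_w (\prod_i f i (X i w))%:E)%E = (\prod_i mean f i)%:E.
Proof.
elim: K => [|k K IH] f gf fK.
  have f0 i x : 0 <= f i x by apply: fK.
  have e : (\int[P]_w (\prod_i f i (X i w))%:E)%E = (\prod_i mean f i)%:E.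
    by apply: (indep_ge0 (K := enum I)) => // i; rewrite mem_enum.
  split=> //; apply/integrableP; split.
    apply/measurable_EFinP.
    by apply: (measurable_prodf predT) => i; exact: (gf i).1.
  rewrite (eq_integral (fun w => (\prod_i f i (X i w))%:E)) ?e ?ltry// => w _.
  by rewrite abse_EFin ger0_norm// prodr_ge0.
have gu (g : R -> R) : measurable_fun setT g ->
    (forall x, 0 <= g x) -> (forall x, `|g x| <= `|f k x|) ->
    good (update f k g) /\
    (forall i, i \notin K -> forall x, 0 <= update f k g i x).
  move=> mg g0 gle; split=> i; rewrite /update; case: eqP => [->|/eqP ik] //.
  - split=> //; apply: (le_integrable measurableT) (gf k).2.
    + by apply/measurable_EFinP; exact: measurableT_comp.
    + by move=> w _; rewrite lee_fin.
  - by move=> iK; apply: fK; rewrite inE negb_or ik.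
have mfk := (gf k).1.
have [gp p0] : good (update f k (f k)^\+) /\
    (forall i, i \notin K -> forall x, 0 <= update f k (f k)^\+ i x).
  apply: gu => [|x|x]; [exact: measurable_funrpos|by rewrite /funrpos le_max
    lexx orbT|].
  by rewrite /funrpos ger0_norm ?le_max ?lexx ?orbT// ge_max normr_ge0 ler_norm.
have [gn n0] : good (update f k (f k)^\-) /\
    (forall i, i \notin K -> forall x, 0 <= update f k (f k)^\- i x).
  apply: gu => [|x|x]; [exact: measurable_funrneg|by rewrite /funrneg le_max
    lexx orbT|].
  by rewrite /funrneg ger0_norm ?le_max ?lexx ?orbT// ge_max normr_ge0 -normrN
    ler_norm.
have [ip ep] := IH _ gp p0.
have [inn en] := IH _ gn n0.
have fE w : (\prod_i f i (X i w))%:E =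
    ((\prod_i update f k (f k)^\+ i (X i w))%:E -
     (\prod_i update f k (f k)^\- i (X i w))%:E)%E.
  rewrite !prodE -EFinB -mulrBl (bigD1 k)//=; congr (_ * _)%:E.
  by rewrite -[in LHS](funrposBneg (f k)).
have ik : mean f k = mean (update f k (f k)^\+) k - mean (update f k (f k)^\-)
  k.
  apply: EFin_inj; rewrite EFinB -!meanK// /update eqxx -integralB//.
  - by apply: eq_integral => w _; rewrite -EFinB -[in LHS](funrposBneg (f k)).
  - by have := (gp k).2; rewrite /update eqxx.
  - by have := (gn k).2; rewrite /update eqxx.
split.
  by apply: eq_integrable (integrableB measurableT ip inn) => // w _;
    rewrite fE.
under eq_integral do rewrite fE.
rewrite integralB// ep en -EFinB; congr EFin.
rewrite (bigD1 k)//= [X in _ - X](bigD1 k)//= [RHS](bigD1 k)//= ik mulrBl.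
by congr (_ * _ - _ * _); apply: eq_bigr => i nik; rewrite mean_update.
Qed.

Lemma independent_moments (k : I -> nat) :
  (forall i, P.-integrable setT (fun w => (X i w ^+ k i)%:E)) ->
  P.-integrable setT (fun w => (\prod_i X i w ^+ k i)%:E) /\
  (\int[P]_w (\prod_i X i w ^+ k i)%:E)%E =
    (\prod_i fine (\int[P]_w (X i w ^+ k i)%:E)%E)%:E.
Proof.
move=> iX; apply: (independent_prod (K := enum I) (f := fun i x => x ^+ k i)).
  by move=> i; split; [exact: measurable_funX|exact: iX].
by move=> i; rewrite mem_enum.
Qed.

End Independence.

(** * Wick's formula *)

Section SplitSum.
Context (T : Type).

(* the sum of [F a x b] over all decompositions [s = a ++ x :: b] *)
Fixpoint split_sum (V : nmodType) (F : seq T -> T -> seq T -> V) (s : seq T) :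
  V :=
  if s is x :: s' then F [::] x s' + split_sum (fun a => F (x :: a)) s' else 0.

(** The decomposition of [s] is available in the hypothesis because the later inductions on word
    length need the sizes of [a] and [b]. *)
Lemma eq_split_sum (V : nmodType) (F G : seq T -> T -> seq T -> V) s :
  (forall a x b, s = a ++ x :: b -> F a x b = G a x b) ->
  split_sum F s = split_sum G s.
Proof.
elim: s F G => //= x s IH F G FG; congr (_ + _); first exact: FG.
by apply: IH => a y b sE; apply: FG; rewrite sE.
Qed.

Lemma split_sum_morph (V W : nmodType) (f : V -> W) F s :
  f 0 = 0 -> {morph f : x y / x + y} ->
  f (split_sum F s) = split_sum (fun a x b => f (F a x b)) s.
Proof. by move=> f0 fD; elim: s F => //= x s IH F; rewrite fD IH. Qed.

Lemma split_sum0 (V : nmodType) s : split_sum (fun _ _ _ => 0 : V) s = 0.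
Proof. by elim: s => //= x s ->; rewrite addr0. Qed.

Lemma split_sumD (V : nmodType) (F G : seq T -> T -> seq T -> V) s :
  split_sum (fun a x b => F a x b + G a x b) s = split_sum F s + split_sum G s.
Proof. by elim: s F G => [|x s IH] F G /=; rewrite ?addr0// IH addrACA. Qed.

Lemma split_sum_sum (V : nmodType) (J : Type) (r : seq J) (Q : pred J)
    (F : J -> seq T -> T -> seq T -> V) s :
  \sum_(j <- r | Q j) split_sum (F j) s =
  split_sum (fun a x b => \sum_(j <- r | Q j) F j a x b) s.
Proof.
elim: s F => [|x s IH] F /=; first by rewrite big1.
by rewrite big_split IH.
Qed.

(** Both sides run over all [s = a ++ x :: c ++ y :: d]; one cuts first at [x], the other first at
    [y]. *)
Lemma split_sum_assoc (V : nmodType)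
    (F : seq T -> T -> seq T -> T -> seq T -> V) s :
  split_sum (fun a x b => split_sum (fun c y d => F a x c y d) b) s =
  split_sum (fun t y d => split_sum (fun a x c => F a x c y d) t) s.
Proof.
elim: s F => //= x s IH F; rewrite add0r IH -split_sumD.
by apply: eq_split_sum.
Qed.

End SplitSum.

Section Wick.
Context (dO : measure_display) (Omega : measurableType dO) (R : realType)
  (P : probability Omega R) (I : finType) (X : I -> Omega -> R).
Hypotheses (gX : forall i, centered_gaussian P (X i))
  (indX : mutually_independent P X).
Implicit Types (s m : seq I) (i j : I) (w : Omega).

Definition moment s : R := fine (\int[P]_w (\prod_(i <- s) X i w)%:E)%E.

Definition second_moment i : R := fine (\int[P]_w (X i w ^+ 2)%:E)%E.

Let mX i : measurable_fun setT (X i). Proof. by have [] := gX i. Qed.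

Let count_prod (S : comPzRingType) (f : I -> S) s :
  \prod_(i <- s) f i = \prod_i f i ^+ count_mem i s.
Proof.
elim: s => [|x s IH]; first by rewrite big_nil big1// => i _; rewrite expr0.
rewrite big_cons IH (bigD1 x)//= [RHS](bigD1 x)//= eqxx mulrA -exprS;
  congr (_ * _).
by apply: eq_bigr => i /negPf ix; rewrite eq_sym ix.
Qed.

Let monomialP s := independent_moments mX indX
  (fun i => (centered_gaussian_moments (gX i)).1 (count_mem i s)).

Let m1 i k : R := fine (\int[P]_w (X i w ^+ k)%:E)%E.

Let momentE s : moment s = \prod_i m1 i (count_mem i s).
Proof.
rewrite /moment; under eq_integral do rewrite count_prod.
by rewrite (monomialP s).2.
Qed.

Lemma integrable_monomial s :
  P.-integrable setT (fun w => (\prod_(i <- s) X i w)%:E).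
Proof. by under eq_fun do rewrite count_prod; exact: (monomialP s).1. Qed.

Lemma moment0 : moment [::] = 1.
Proof.
rewrite /moment; under eq_integral do rewrite big_nil.
by rewrite integral_cst// mul1e; rewrite [X in fine X](_ : _ = 1%E)//;
  exact: probability_setT.
Qed.

Let m1S i k : m1 i k.+1 = k%:R * second_moment i * m1 i k.-1.
Proof.
have [iX mS] := centered_gaussian_moments (gX i).
have fin l : (\int[P]_w (X i w ^+ l)%:E)%E \is a fin_num.
  exact: integrable_fin_num.
by rewrite /m1 mS !fineM// fin_numM.
Qed.

(** By independence only the power of [X i] changes. All occurrences of [i] in [s] contribute the
    same term, and their number is the factor [k] of the one-variable recursion. *)
Lemma moment_cons i s : moment (i :: s) = split_sum (fun a j b =>
  if j == i then second_moment i * moment (a ++ b) else 0) s.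
Proof.
pose c := second_moment i *
   (m1 i (count_mem i s).-1 * \prod_(j | j != i) m1 j (count_mem j s)).
transitivity (split_sum (fun a j b => if j == i then c else 0) s); last first.
  apply: eq_split_sum => a j b sE; case: eqP => // ji; congr (_ * _).
  rewrite momentE [RHS](bigD1 i)//= sE ji; congr (_ * _).
    by congr m1; rewrite !count_cat/= eqxx addnS.
  apply: eq_bigr => k /negPf ki; congr m1.
  by rewrite !count_cat/= eq_sym ki.
transitivity (c *+ count_mem i s).
  rewrite momentE (bigD1 i)//= eqxx m1S /c.
  rewrite -[RHS]mulr_natl !mulrA; congr (_ * _).
  by apply: eq_bigr => k /negPf ki; rewrite eq_sym ki.
move: c => c; elim: s => //= x s IH.
by rewrite mulrnDr IH; case: eqP.
Qed.

End Wick.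

(** * Integration by parts for polynomials in independent Gaussian variables *)

Section GaussianDerivation.
Context (dO : measure_display) (Omega : measurableType dO) (R : realType)
  (P : probability Omega R) (I : finType) (X : I -> Omega -> R).
Hypotheses (gX : forall i, centered_gaussian P (X i))
  (indX : mutually_independent P X).
Implicit Types (s m : seq I) (i : I) (w : Omega) (c : R[i])
  (l : seq (R[i] * seq I)) (F G : Omega -> R[i]) (kappa : I -> R[i]).
Local Notation E := (complex_expectation P).

Definition monomial s w : R[i] := \prod_(i <- s) (X i w)%:C.

Definition polynomial_expr l w : R[i] := \sum_(t <- l) t.1 * monomial t.2 w.

Let monomialE s w : monomial s w = (\prod_(i <- s) X i w)%:C.
Proof. by rewrite /monomial rmorph_prod. Qed.

Lemma expectation_polynomial l :
  E (polynomial_expr l) = \sum_(t <- l) t.1 * (moment P X t.2)%:C.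
Proof.
(* Integrability is carried along the induction, since [complex_expectation] is additive only where
   the integrals are finite. *)
suff [_ _ ->] : [/\ P.-integrable setT
  (fun w => (complex.Re (polynomial_expr l w))%:E),
    P.-integrable setT (fun w => (complex.Im (polynomial_expr l w))%:E) &
    E (polynomial_expr l) = \sum_(t <- l) t.1 * (moment P X t.2)%:C] by [].
have expE (f : Omega -> R) : ('E_P[f] = \int[P]_w (f w)%:E)%E by rewrite unlock.
rewrite /complex_expectation.
elim: l => [|[c s] l [iR iI IH]].
  have nilE w : polynomial_expr [::] w = 0 by exact: big_nil.
  rewrite big_nil; split.
  - apply: (eq_integrable measurableT (cst 0%E)); last exact: integrable0.
    by move=> w _; rewrite nilE.
  - apply: (eq_integrable measurableT (cst 0%E)); last exact: integrable0.
    by move=> w _; rewrite nilE.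
  - by rewrite !expE !integral0_eq// => w _; rewrite nilE.
have imon := integrable_monomial gX indX s.
have fimon : (\int[P]_w (\prod_(i <- s) X i w)%:E)%E \is a fin_num.
  exact: integrable_fin_num.
have step (f g : R[i] -> R) :
    P.-integrable setT (fun w => (f (polynomial_expr l w))%:E) ->
    (forall w, f (polynomial_expr ((c, s) :: l) w) =
       g c * (\prod_(i <- s) X i w) + f (polynomial_expr l w)) ->
    P.-integrable setT (fun w => (f (polynomial_expr ((c, s) :: l) w))%:E) /\
    fine (\int[P]_w (f (polynomial_expr ((c, s) :: l) w))%:E)%E =
    g c * moment P X s + fine (\int[P]_w (f (polynomial_expr l w))%:E)%E.
  move=> fi fE.
  have ig : P.-integrable setT
    (fun w => (g c)%:E * (\prod_(i <- s) X i w)%:E)%E.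
    exact: integrableZl.
  split.
    by apply: eq_integrable (integrableD measurableT ig fi) => // w _;
      rewrite fE EFinD EFinM.
  rewrite (eq_integral (fun w => (g c)%:E * (\prod_(i <- s) X i w)%:E +
    (f (polynomial_expr l w))%:E))%E; last first.
    by move=> w _; rewrite fE EFinD EFinM.
  rewrite integralD// integralZl// fineD//; last 2 first.
  - by rewrite fin_numM.
  - exact: integrable_fin_num.
  by rewrite fineM.
have peval_cons w : polynomial_expr ((c, s) :: l) w =
    c * (\prod_(i <- s) X i w)%:C + polynomial_expr l w.
  by rewrite /polynomial_expr big_cons monomialE.
have [|iR' eR] := step (@complex.Re R) (@complex.Re R) iR.
  by move=> w; rewrite peval_cons;
    case: (polynomial_expr l w) (c) => [a b] [x y] /=; ring.
have [|iI' eI] := step (@complex.Im R) (@complex.Im R) iI.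
  by move=> w; rewrite peval_cons;
    case: (polynomial_expr l w) (c) => [a b] [x y] /=; ring.
split=> //; rewrite big_cons -IH !expE /= eR eI.
by case: (c) => a b /=; apply/eqP; rewrite eq_complex /=; apply/andP; split;
  apply/eqP; ring.
Qed.

(** This is the class on which [complex_expectation] is used as a linear functional. *)
Definition is_polynomial F := exists l, F =1 polynomial_expr l.

Lemma polynomial_lin (J : Type) (r : seq J) (a : J -> R[i])
  (F : J -> Omega -> R[i]) :
  (forall j, is_polynomial (F j)) ->
  is_polynomial (fun w => \sum_(j <- r) a j * F j w) /\
  E (fun w => \sum_(j <- r) a j * F j w) = \sum_(j <- r) a j * E (F j).
Proof.
move=> /choice[l hl].
pose L := flatten [seq [seq (a j * t.1, t.2) | t <- l j] | j <- r].
have FE : (fun w => \sum_(j <- r) a j * F j w) = polynomial_expr L.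
  apply/funext => w; rewrite /polynomial_expr /L big_flatten/= big_map.
  apply: eq_bigr => j _; rewrite big_map hl mulr_sumr.
  by apply: eq_bigr => t _; rewrite mulrA.
split; first by exists L; rewrite FE.
rewrite FE expectation_polynomial big_flatten/= big_map.
apply: eq_bigr => j _; rewrite big_map (_ : F j = polynomial_expr (l j)).
  by rewrite expectation_polynomial mulr_sumr; apply: eq_bigr => t _;
    rewrite mulrA.
by apply/funext => w; exact: hl.
Qed.

Lemma is_polynomial_monomial s : is_polynomial (monomial s).
Proof. by exists [:: (1, s)] => w; rewrite /polynomial_expr big_seq1 mul1r. Qed.

Lemma expectation_monomial s : E (monomial s) = (moment P X s)%:C.
Proof.
have -> : monomial s = polynomial_expr [:: (1, s)].
  by apply/funext => w; rewrite /polynomial_expr big_seq1 mul1r.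
by rewrite expectation_polynomial big_seq1 mul1r.
Qed.

Lemma polynomialD F G : is_polynomial F -> is_polynomial G ->
  is_polynomial (fun w => F w + G w) /\ E (fun w => F w + G w) = E F + E G.
Proof.
move=> pF pG.
have [|] := @polynomial_lin bool [:: true; false] (fun=> 1)
  (fun b => if b then F else G).
  by case.
rewrite (_ : (fun w => _) = (fun w => F w + G w)).
  by rewrite !big_cons big_nil !mul1r addr0.
by apply/funext => w; rewrite !big_cons big_nil !mul1r addr0.
Qed.

Lemma polynomialZ c F : is_polynomial F ->
  is_polynomial (fun w => c * F w) /\ E (fun w => c * F w) = c * E F.
Proof.
move=> pF.
have [|] := @polynomial_lin unit [:: tt] (fun=> c) (fun=> F) => //.
rewrite (_ : (fun w => _) = (fun w => c * F w)); first by rewrite big_seq1.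
by apply/funext => w; rewrite big_seq1.
Qed.

Lemma polynomial_split_sum (T : Type)
  (F : seq T -> T -> seq T -> Omega -> R[i]) (s : seq T) :
  (forall a x b, is_polynomial (F a x b)) ->
  is_polynomial (fun w => split_sum (fun a x b => F a x b w) s) /\
  E (fun w => split_sum (fun a x b => F a x b w) s) =
    split_sum (fun a x b => E (F a x b)) s.
Proof.
elim: s F => [|x s IH] F pF /=.
  have [|] := @polynomial_lin unit [::] (fun=> 1) (fun=> (monomial [::])).
    by move=> _; exact: is_polynomial_monomial.
  rewrite (_ : (fun w => _) = (fun=> 0)); first by rewrite big_nil.
  by apply/funext => w; rewrite big_nil.
have [p1 <-] := IH (fun a => F (x :: a)) (fun a => pF (x :: a)).
exact: polynomialD.
Qed.

Definition gaussian_derivative kappa m w : R[i] :=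
  split_sum (fun a j b => kappa j * monomial (a ++ b) w) m.

(* [G] is the image of [F] under the derivation [X i |-> kappa i] of polynomial
   expressions; a relation, as an expression need not be determined by the
   random variable that it represents *)
Definition is_derivation kappa F G := exists l, F =1 polynomial_expr l /\
  forall w, G w = \sum_(t <- l) t.1 * gaussian_derivative kappa t.2 w.

Lemma is_derivation_polynomial kappa F G : is_derivation kappa F G ->
  is_polynomial F /\ is_polynomial G.
Proof.
move=> [l [Fl Gl]]; split; first by exists l.
rewrite (_ : G = fun w => \sum_(t <- l) t.1 * gaussian_derivative kappa t.2 w).
  apply: (polynomial_lin _ _ _).1 => t.
  apply: (polynomial_split_sum _ _).1 => a x b.
  exact: (polynomialZ _ (is_polynomial_monomial _)).1.
exact/funext.
Qed.

(** The derivation sends [X i] to its covariance with the linear form, which by independence is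
    [alpha i] times the variance. On each monomial the identity is [moment_cons], summed over
    [i]. *)
Lemma gaussian_integration_by_parts (alpha : I -> R[i]) F G :
  is_derivation (fun i => alpha i * (second_moment P X i)%:C) F G ->
  E (fun w => (\sum_i alpha i * (X i w)%:C) * F w) = E G.
Proof.
move=> [l [Fl Gl]].
have -> : (fun w => (\sum_i alpha i * (X i w)%:C) * F w) =
    (fun w => \sum_(t <- l) t.1 * \sum_i alpha i * monomial (i :: t.2) w).
  apply/funext => w; rewrite Fl mulr_sumr; apply: eq_bigr => t _.
  rewrite mulrCA; congr (_ * _); rewrite mulr_suml; apply: eq_bigr => i _.
  by rewrite /monomial big_cons mulrA.
have -> : G = (fun w => \sum_(t <- l) t.1 *
    gaussian_derivative (fun i => alpha i * (second_moment P X i)%:C) t.2 w).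
  exact/funext.
have pm t : is_polynomial (fun w => \sum_i alpha i * monomial (i :: t) w).
  by apply: (polynomial_lin _ _ _).1 => i; exact: is_polynomial_monomial.
have pz c s := polynomialZ c (is_polynomial_monomial s).
have pd t kappa : is_polynomial (gaussian_derivative kappa t).
  by apply: (polynomial_split_sum _ _).1 => a x b; exact: (pz _ _).1.
rewrite (polynomial_lin _ _ (fun t => pm t.2)).2
  (polynomial_lin _ _ (fun t => pd t.2 _)).2.
apply: eq_bigr => t _; congr (_ * _).
rewrite (polynomial_lin _ _ (fun i => is_polynomial_monomial (i :: t.2))).2.
rewrite (polynomial_split_sum t.2 (fun a x b => (pz _ (a ++ b)).1)).2.
under eq_bigr do rewrite expectation_monomial (moment_cons gX indX).
under [RHS]eq_split_sum do rewrite (pz _ _).2 expectation_monomial.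
rewrite -[RHS](_ : split_sum (fun a x b => \sum_i alpha i *
   (if x == i then second_moment P X i * moment P X (a ++ b) else 0)%:C) t.2 =
     _); last first.
  apply: eq_split_sum => a x b _; rewrite (bigD1 x)//= eqxx big1 ?addr0.
    by rewrite rmorphM mulrA.
  by move=> i /negPf ix; rewrite eq_sym ix mulr0.
rewrite -split_sum_sum; apply: eq_bigr => i _.
rewrite (split_sum_morph (f := fun x : R => alpha i * x%:C))//;
  first by rewrite mulr0.
by move=> x y; rewrite rmorphD mulrDr.
Qed.

Lemma is_derivation_cst kappa c : is_derivation kappa (fun=> c) (fun=> 0).
Proof.
exists [:: (c, [::])]; split=> w.
  by rewrite /polynomial_expr big_seq1 /monomial big_nil mulr1.
by rewrite big_seq1 /gaussian_derivative/= mulr0.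
Qed.

Lemma is_derivation_lin kappa (J : Type) (r : seq J) (a : J -> R[i])
    (F G : J -> Omega -> R[i]) : (forall j, is_derivation kappa (F j) (G j)) ->
  is_derivation kappa (fun w => \sum_(j <- r) a j * F j w)
    (fun w => \sum_(j <- r) a j * G j w).
Proof.
move=> /choice[l hl].
exists (flatten [seq [seq (a j * t.1, t.2) | t <- l j] | j <- r]); split=> w.
  rewrite /polynomial_expr big_flatten/= big_map.
  apply: eq_bigr => j _; rewrite big_map (hl j).1 mulr_sumr.
  by apply: eq_bigr => t _; rewrite mulrA.
rewrite big_flatten/= big_map.
apply: eq_bigr => j _; rewrite big_map (hl j).2 mulr_sumr.
by apply: eq_bigr => t _; rewrite mulrA.
Qed.

Lemma is_derivation_var kappa i : is_derivation kappa (fun w => (X i w)%:C)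
  (fun=> kappa i).
Proof.
exists [:: (1, [:: i])]; split=> w.
  by rewrite /polynomial_expr big_seq1 /monomial big_seq1 mul1r.
by rewrite big_seq1 /gaussian_derivative/= /monomial big_nil mul1r mulr1 addr0.
Qed.

Let gaussian_derivative_cat kappa m1 m2 w :
  gaussian_derivative kappa (m1 ++ m2) w =
  gaussian_derivative kappa m1 w * monomial m2 w +
  monomial m1 w * gaussian_derivative kappa m2 w.
Proof.
have cons i m : gaussian_derivative kappa (i :: m) w =
    kappa i * monomial m w + (X i w)%:C * gaussian_derivative kappa m w.
  rewrite /gaussian_derivative/=; congr (_ + _).
  rewrite (split_sum_morph (f := fun x => (X i w)%:C * x)) ?mulr0//.
    by apply: eq_split_sum => a x b _; rewrite /monomial big_cons mulrCA.
  by move=> x y; rewrite mulrDr.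
elim: m1 => [|i m1 IH] /=.
  by rewrite /gaussian_derivative/= /monomial big_nil mul0r mul1r add0r.
rewrite !cons IH /monomial big_cons big_cat /=; ring.
Qed.

Lemma is_derivationM kappa F1 F2 G1 G2 :
  is_derivation kappa F1 G1 -> is_derivation kappa F2 G2 ->
  is_derivation kappa (fun w => F1 w * F2 w)
    (fun w => G1 w * F2 w + F1 w * G2 w).
Proof.
move=> [l1 [F1l G1l]] [l2 [F2l G2l]].
exists [seq (t1.1 * t2.1, t1.2 ++ t2.2) | t1 <- l1, t2 <- l2]; split=> w.
  rewrite /polynomial_expr big_allpairs_dep F1l F2l big_distrl/=.
  apply: eq_bigr => t1 _; rewrite big_distrr/=.
  by apply: eq_bigr => t2 _; rewrite /monomial big_cat/= mulrACA.
rewrite big_allpairs_dep F1l F2l G1l G2l !big_distrl/= -big_split/=.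
apply: eq_bigr => t1 _; rewrite !big_distrr/= -big_split/=.
by apply: eq_bigr => t2 _; rewrite gaussian_derivative_cat; ring.
Qed.

End GaussianDerivation.

(** * Loop equation *)

(** Sorting encodes unordered pairs; this decides when two matrix entries are built from the same
    independent variables. *)
Lemma sorted_pair_eq (n : nat) (a b c d : 'I_n) :
  ((if (a <= b)%N then (a, b) else (b, a)) ==
   (if (c <= d)%N then (c, d) else (d, c)))
  = (c == a) && (d == b) || (c == b) && (d == a).
Proof.
rewrite ![c == _]eq_sym ![d == _]eq_sym -!val_eqE/=.
case: (leqP a b) => ab; case: (leqP c d) => cd; rewrite xpair_eqE -!val_eqE/=;
  by apply/idP/idP; lia.
Qed.

Section HGRM.
Context (R : realType) (r : nat) (U : finType) (n : nat)
  (N : 'I_r -> {set 'I_n}) (V : U -> 'M[R]_r)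
  (dO : measure_display) (Omega : measurableType dO) (P : probability Omega R)
  (Y : U -> Omega -> 'M[R[i]]_n).
Hypotheses (hN : interval_partition N) (Vsym : forall u p q, V u p q = V u q p)
  (hY : HGRM P N V Y).
Implicit Types (u v : U) (p q : 'I_r) (i j k l : 'I_n) (w : Omega)
  (s t : seq (U * 'I_r)).
Local Notation X := (entry_part Y).
Local Notation idx := (entry_index U n).
Local Notation E := (complex_expectation P).

Let gX : forall x : idx, centered_gaussian P (X x) := HGRM_gaussian hY.
Let indX : mutually_independent P X := HGRM_independent hY.

Lemma block_eq p q i : i \in N p -> i \in N q -> p = q.
Proof.
move=> ip iq; apply/eqP; apply: contraT => pq; have [_ /(_ _ _ pq) h _ _] := hN.
by have := finset.in_set0 i; rewrite -h finset.in_setI ip iq.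
Qed.

Lemma block_ex i : exists p, i \in N p.
Proof.
have [_ _ h _] := hN; have := finset.in_setT i; rewrite -h.
by case/bigcupP => p _ ip; exists p.
Qed.

Definition sorted_entry u i j : U * ('I_n * 'I_n) :=
  (u, if (i <= j)%N then (i, j) else (j, i)).

Let sorted_entryP u i j (b : bool) :
  ((sorted_entry u i j, b).1.2.1 <= (sorted_entry u i j, b).1.2.2)%N.
Proof. by rewrite /sorted_entry/=; case: (leqP i j) => /= [|/ltnW]. Qed.

Definition entry_idx u i j (b : bool) : idx :=
  Sub (sorted_entry u i j, b) (sorted_entryP u i j b).

(** The coefficients of $Y_{i,j}$ as a linear form in the independent variables. Below the diagonal
    the entry is the conjugate of a stored one, whence the sign of ['i]. *)
Definition entry_coef u i j (x : idx) : R[i] :=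
  ((val x).1 == sorted_entry u i j)%:R *
  (if (val x).2 then 1 else if (i <= j)%N then 'i else - 'i).

Let sum_entry_coef u i j (f : idx -> R[i]) :
  \sum_x entry_coef u i j x * f x =
  f (entry_idx u i j true) + (if (i <= j)%N then 'i else - 'i) * f
    (entry_idx u i j false).
Proof.
rewrite (bigD1 (entry_idx u i j true))//= (bigD1 (entry_idx u i j false))/=;
  last first.
  by rewrite -val_eqE/= xpair_eqE andbF.
rewrite big1 ?addr0; last first.
  case=> -[y b] yb; rewrite -!val_eqE/= /entry_coef/= => /andP[xt xf].
  case: eqP => [yE|]; last by rewrite !mul0r.
  by exfalso; move: xt xf; rewrite yE; case: (b); rewrite eqxx.
by rewrite /entry_coef/= eqxx !mul1r.
Qed.

Let herm u w i j : Y u w j i = (Y u w i j)^*.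
Proof.
have /is_hermitianmxP h := HGRM_hermitian hY u w.
by rewrite {1}h expr0 scale1r !mxE.
Qed.

Lemma entry_expand u w i j :
  Y u w i j = \sum_x entry_coef u i j x * (X x w)%:C.
Proof.
rewrite sum_entry_coef /entry_part/= /sorted_entry.
case: leqP => ij /=.
  exact: complexE.
rewrite herm; case: (Y u w j i) => a b.
by apply/eqP; rewrite eq_complex/=
  !(mul0r, mulr0, mul1r, oppr0, addr0, add0r, subr0, sub0r, mulN1r,mulNr) !eqxx.
Qed.

Let expE (f : Omega -> R) : ('E_P[f] = \int[P]_w (f w)%:E)%E.
Proof. by rewrite unlock. Qed.

Let entry_partE u i j b w : X (entry_idx u i j b) w =
  (if b then @complex.Re R else @complex.Im R)
    (Y u w (if (i <= j)%N then i else j) (if (i <= j)%N then j else i)).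
Proof. by rewrite /entry_part/=; case: (leqP i j). Qed.

Let second_moment_offdiag u p q i j b : i \in N p -> j \in N q -> i != j ->
  second_moment P X (entry_idx u i j b) = V u p q / (2 * n%:R).
Proof.
move=> ip jq ij; rewrite /second_moment.
under eq_integral do rewrite entry_partE.
rewrite -(expE (fun w => _ ^+ 2)).
have [ij'|ij'] := leqP i j; case: b.
- by rewrite (HGRM_var_Re hY u ip jq ij).
- by rewrite (HGRM_var_Im hY u ip jq ij).
- rewrite (HGRM_var_Re hY u jq ip) 1?eq_sym//=; by rewrite Vsym.
- rewrite (HGRM_var_Im hY u jq ip) 1?eq_sym//=; by rewrite Vsym.
Qed.

Let Im_diag u w i : complex.Im (Y u w i i) = 0.
Proof.
have := herm u w i i; case: (Y u w i i) => a b /= [] /eqP.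
by rewrite -addr_eq0 -mulr2n mulrn_eq0/= => /eqP.
Qed.

Let second_moment_diag u p i b : i \in N p ->
  second_moment P X (entry_idx u i i b) = if b then V u p p / n%:R else 0.
Proof.
move=> ip; rewrite /second_moment.
under eq_integral do rewrite entry_partE leqnn.
case: b; last first.
  by rewrite integral0_eq// => w _; rewrite Im_diag expr0n.
rewrite -(expE (fun w => _ ^+ 2)).
have := HGRM_var_diag hY u ip.
rewrite (_ : (fun w => _) = (fun w => complex.Re (Y u w i i) ^+ 2)) => [->//|].
apply/funext => w; have := Im_diag u w i.
case: (Y u w i i) => a c /= ->.
by rewrite expr0n addr0 sqr_sqrtr ?sqr_ge0.
Qed.

(* By [gaussian_integration_by_parts], multiplication by [Y u w i j] amounts under
   the expectation to the derivation in this direction. *)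
Definition entry_dir u i j (x : idx) : R[i] :=
  entry_coef u i j x * (second_moment P X x)%:C.

(** This is $E(Y_{k,l}Y_{i,j})$. Off the diagonal, the real and imaginary parts have equal
    variances: their contributions add up for $(k,l) = (j,i)$ and cancel for $(k,l) = (i,j)$,
    because $i^2 = -1$. On the diagonal both cases coincide and only the real part counts. *)
Lemma entry_covariance u p q i j v k l : i \in N q -> j \in N p ->
  \sum_x entry_coef v k l x * entry_dir u i j x =
  ([&& v == u, k == j & l == i])%:R * (V u q p / n%:R)%:C.
Proof.
move=> iq jp; under eq_bigr do rewrite /entry_dir mulrCA.
rewrite sum_entry_coef /entry_coef /=.
have -> : (sorted_entry u i j == sorted_entry v k l) =
    (v == u) && ((k == i) && (l == j) || (k == j) && (l == i)).
  by rewrite /sorted_entry xpair_eqE eq_sym sorted_pair_eq.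
case: (v == u); rewrite ?mul0r ?mulr0 ?addr0//=.
have sqi : ('i * 'i : R[i]) = -1 by rewrite -expr2 sqr_i.
have [ij|ij] := eqVneq i j.
  subst j; rewrite (block_eq jp iq) !(second_moment_diag _ _ iq) orbb.
  by rewrite !mulr0 addr0 mulr1.
rewrite !(second_moment_offdiag _ _ iq jp ij).
have VE : (V u q p / (2 * n%:R))%:C + (V u q p / (2 * n%:R))%:C =
  (V u q p / n%:R)%:C :> R[i].
  by rewrite -rmorphD/=; congr (_%:C);
    rewrite invfM mulrCA [2^-1 * _]mulrC -splitr.
have [kj|kj] := eqVneq k j; have [li|li] := eqVneq l i;
  rewrite ?orbT ?orbF ?andbF ?andbT/=.
- subst k l; rewrite !mul1r -VE; congr (_ + _); rewrite mulrA.
  have [ij'|ij'|/val_inj e] := ltngtP i j; last by rewrite e eqxx in ij.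
    by rewrite mulrN sqi opprK mul1r.
  by rewrite mulNr sqi opprK mul1r.
- by subst k; rewrite eq_sym (negPf ij) !mul0r mulr0 addr0.
- by subst l; rewrite (negPf ij) andbF !mul0r mulr0 addr0.
have [ki|ki] := eqVneq k i; have [lj|lj] := eqVneq l j;
  rewrite ?mul0r ?mulr0 ?addr0//.
subst k l; rewrite !mul1r mulrA; case: ifP => _.
  by rewrite sqi mulN1r subrr.
by rewrite mulrNN sqi mulN1r subrr.
Qed.

Lemma is_derivation_entry u p q i j v k l : i \in N q -> j \in N p ->
  is_derivation X (entry_dir u i j) (fun w => Y v w k l)
    (fun=> ([&& v == u, k == j & l == i])%:R * (V u q p / n%:R)%:C).
Proof.
move=> iq jp; rewrite -(entry_covariance u v k l iq jp).
rewrite (_ : (fun w => _) = (fun w => \sum_x entry_coef v k l x * (X x w)%:C)).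
  by apply: is_derivation_lin => x; exact: is_derivation_var.
by apply/funext => w; exact: entry_expand.
Qed.

(* [:: (u_1, p_1); ...; (u_m, p_m)] stands for Y(u_1) D_{p_1} ... Y(u_m) D_{p_m}. *)
Fixpoint path_mx s w : 'M[R[i]]_n :=
  if s is (u, p) :: s' then Y u w *m block_diag R N p *m path_mx s' w else 1%:M.

Lemma path_mx_cons u p s w k l :
  path_mx ((u, p) :: s) w k l = \sum_(j in N p) Y u w k j * path_mx s w j l.
Proof.
rewrite /= mxE [RHS]big_mkcond; apply: eq_bigr => j _.
rewrite mul_mx_diag !mxE; case: (j \in N p); rewrite ?mulr1// mulr0 mul0r//.
Qed.

Lemma path_mx_cat s t w : path_mx (s ++ t) w = path_mx s w *m path_mx t w.
Proof. by elim: s => [|[u p] s IH] /=; rewrite ?mul1mx// IH mulmxA. Qed.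

Definition path_end q s : 'I_r := last q (unzip2 s).

Lemma path_mx_out q s w k l : k \in N q -> l \notin N (path_end q s) ->
  path_mx s w k l = 0.
Proof.
elim: s q k => [|[u p] s IH] q k kq lN.
  by rewrite mxE; case: eqP => // kl; rewrite -kl kq in lN.
by rewrite path_mx_cons big1// => j jp; rewrite (IH p)// mulr0.
Qed.

(** Differentiating one letter replaces its matrix by a multiple of the matrix unit at $(j,i)$,
    which cuts the word into an entry of [a] ending at [j] and an entry of [b] starting at [i]. The
    projection attached to that letter keeps [i] only if its block is [q]. *)
Lemma is_derivation_path u p q i j s k l : i \in N q -> j \in N p ->
  is_derivation X (entry_dir u i j) (fun w => path_mx s w k l)
    (fun w => split_sum (fun a z b => ((z.1 == u) && (z.2 == q))%:R *
       (V u q p / n%:R)%:C * (path_mx a w k j * path_mx b w i l)) s).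
Proof.
move=> iq jp; elim: s k l => [|[v p'] s IH] k l.
  exact: is_derivation_cst.
set c := (V u q p / n%:R)%:C.
have := is_derivation_lin (enum (N p')) (fun=> 1)
  (fun h => is_derivationM (is_derivation_entry u v k h iq jp) (IH h l)).
rewrite (_ : (fun w => _) = (fun w => path_mx ((v, p') :: s) w k l));
  last first.
  apply/funext => w; rewrite path_mx_cons big_enum/=.
  by apply: eq_bigr => h _; rewrite mul1r.
rewrite (_ : (fun w => \sum_(h <- _) _) =
  (fun w => split_sum (fun a z b => ((z.1 == u) && (z.2 == q))%:R *
       c * (path_mx a w k j * path_mx b w i l)) ((v, p') :: s)))//.
apply/funext => w; rewrite big_enum/=.
under eq_bigr do rewrite mul1r; rewrite big_split/=; congr (_ + _).
  have -> : (p' == q) = (i \in N p').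
    apply/eqP/idP => [->//|ip]; exact: block_eq ip iq.
  rewrite mxE big_mkcond (bigD1 i)//= eqxx big1 ?addr0; last first.
    by move=> h /negPf hi; rewrite hi !andbF !mul0r if_same.
  rewrite andbT; case: (i \in N p'); rewrite ?andbT ?andbF ?mul0r//.
  by case: (v == u); case: (k == j); rewrite ?mul0r ?mul1r ?mulr0 ?mul0r.
transitivity (\sum_(h in N p') split_sum (fun a z b => Y v w k h *
    (((z.1 == u) && (z.2 == q))%:R * c * (path_mx a w h j * path_mx b w i l)))
      s).
  apply: eq_bigr => h _; apply: (split_sum_morph (f := fun x => Y v w k h * x)).
    exact: mulr0.
  by move=> x y; rewrite mulrDr.
rewrite split_sum_sum; apply: eq_split_sum => a z b _.
rewrite path_mx_cons mulr_suml mulr_sumr; apply: eq_bigr => h _.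
by rewrite mulrCA !mulrA.
Qed.

Definition block_trace q s w : R[i] :=
  (#|N q|%:R)^-1 * \sum_(i in N q) path_mx s w i i.

Definition traces (L : seq ('I_r * seq (U * 'I_r))) w : R[i] :=
  \prod_(z <- L) block_trace z.1 z.2 w.

Definition trace_moment L : R[i] := E (traces L).

Lemma trace_moment_nil : trace_moment [::] = 1.
Proof.
have -> : trace_moment [::] = E (monomial X [::]).
  by congr E; apply/funext => w; rewrite /traces /monomial !big_nil.
by rewrite expectation_monomial// moment0.
Qed.

Let cardN0 q : (#|N q|%:R : R[i]) != 0.
Proof.
have [/(_ q)[j jq] _ _ _] := hN.
by rewrite pnatr_eq0 -lt0n; apply/card_gt0P; exists j.
Qed.

Lemma block_trace_nil q w : block_trace q [::] w = 1.
Proof.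
rewrite /block_trace (eq_bigr (fun=> 1)); first by rewrite sumr_const mulVf.
by move=> i _; rewrite mxE eqxx.
Qed.

Lemma trace_moment_nil_cons q L : trace_moment ((q, [::]) :: L) =
  trace_moment L.
Proof.
by congr E; apply/funext => w; rewrite /traces big_cons block_trace_nil mul1r.
Qed.

Lemma sum_block_path p q s w k (f : 'I_n -> R[i]) : k \in N q ->
  \sum_(j in N p) path_mx s w k j * f j =
  (path_end q s == p)%:R * \sum_j path_mx s w k j * f j.
Proof.
move=> kq; case: eqP => [<-|ne]; last first.
  rewrite mul0r big1// => j jp; rewrite (path_mx_out _ kq) ?mul0r//.
  by apply/negP => jq; apply: ne; exact: block_eq jq jp.
rewrite mul1r big_mkcond; apply: eq_bigr => j _.
by case: ifPn => // jN; rewrite (path_mx_out _ kq)// mul0r.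
Qed.

Lemma is_derivation_block_trace u p q i j q' s : i \in N q -> j \in N p ->
  is_derivation X (entry_dir u i j) (block_trace q' s)
    (fun w => split_sum (fun a z b => ((z.1 == u) && (z.2 == q))%:R *
       (V u q p / n%:R)%:C * ((#|N q'|%:R)^-1 *
       \sum_(k in N q') path_mx a w k j * path_mx b w i k)) s).
Proof.
move=> iq jp.
have := is_derivation_lin (enum (N q')) (fun=> (#|N q'|%:R)^-1)
  (fun k => is_derivation_path u s k k iq jp).
rewrite (_ : (fun w => _) = block_trace q' s); last first.
  by apply/funext => w; rewrite big_enum/= -mulr_sumr.
rewrite (_ : (fun w => \sum_(_ <- _) _) =
  (fun w => split_sum (fun a z b => ((z.1 == u) && (z.2 == q))%:R *
       (V u q p / n%:R)%:C * ((#|N q'|%:R)^-1 *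
       \sum_(k in N q') path_mx a w k j * path_mx b w i k)) s))//.
apply/funext => w; rewrite big_enum/= -mulr_sumr split_sum_sum.
rewrite (split_sum_morph (f := fun x => (#|N q'|%:R)^-1 * x)) ?mulr0//;
  last first.
  by move=> x y; rewrite mulrDr.
by apply: eq_split_sum => a z b _; rewrite -mulr_sumr mulrCA.
Qed.

Lemma is_derivation_traces u p q i j L : i \in N q -> j \in N p ->
  is_derivation X (entry_dir u i j) (traces L)
    (fun w => split_sum (fun L1 z' L2 => traces (L1 ++ L2) w *
      split_sum (fun a z b => ((z.1 == u) && (z.2 == q))%:R *
       (V u q p / n%:R)%:C * ((#|N z'.1|%:R)^-1 *
       \sum_(k in N z'.1) path_mx a w k j * path_mx b w i k)) z'.2) L).
Proof.
move=> iq jp; elim: L => [|[q' s] L IH].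
  rewrite (_ : traces [::] = fun=> 1); first exact: is_derivation_cst.
  by apply/funext => w; exact: big_nil.
have := is_derivationM (is_derivation_block_trace u q' s iq jp) IH.
rewrite (_ : (fun w => _ * _) = traces ((q', s) :: L)); last first.
  by apply/funext => w; rewrite /traces big_cons.
set G1 := (fun w => _ + _); set G2 := (fun w => split_sum _ (_ :: _)).
rewrite (_ : G1 = G2)//; apply/funext => w; rewrite /G1 /G2/=; congr (_ + _).
  by rewrite mulrC.
rewrite (split_sum_morph (f := fun x => block_trace q' s w * x)) ?mulr0//;
  last first.
  by move=> x y; rewrite mulrDr.
by apply: eq_split_sum => L1 z L2 _; rewrite /traces big_cons mulrA.
Qed.

(** The Leibniz rule already constructs the list of the product, so it is applied to arbitrary
    derivatives of the factors, here those for [kappa = 0]. *)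
Let polynomialM F G : is_polynomial X F -> is_polynomial X G ->
  is_polynomial X (fun w => F w * G w).
Proof.
have d H : is_polynomial X H -> exists H', is_derivation X (fun=> 0) H H'.
  by move=> [l hl]; eexists; exists l; split => [//|w]; reflexivity.
move=> /d[F' dF] /d[G' dG].
exact: (is_derivation_polynomial gX indX (is_derivationM dF dG)).1.
Qed.

Lemma polynomial_entry u i j : is_polynomial X (fun w => Y u w i j).
Proof.
have [q iq] := block_ex i; have [p jp] := block_ex j.
exact: (is_derivation_polynomial gX indX (is_derivation_entry u u i j iq jp)).1.
Qed.

Lemma polynomial_path s i j : is_polynomial X (fun w => path_mx s w i j).
Proof.
elim: s i => [|[u p] s IH] i.
  rewrite (_ : (fun w => _) = fun=> (i == j)%:R).
    by have [l [h _]] := is_derivation_cst X (fun=> 0) (i == j)%:R; exists l.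
  by apply/funext => w; rewrite mxE.
rewrite (_ : (fun w => _) =
  fun w => \sum_(k <- enum (N p)) 1 * (Y u w i k * path_mx s w k j)).
  apply: (polynomial_lin gX indX _ _ _).1 => k.
  by apply: polynomialM; [exact: polynomial_entry|exact: IH].
by apply/funext => w; rewrite path_mx_cons big_enum; apply: eq_bigr => k _;
  rewrite mul1r.
Qed.

Lemma polynomial_block_trace q s : is_polynomial X (block_trace q s).
Proof.
rewrite (_ : block_trace q s =
  fun w => \sum_(i <- enum (N q)) (#|N q|%:R)^-1 * path_mx s w i i).
  by apply: (polynomial_lin gX indX _ _ _).1 => i; exact: polynomial_path.
by apply/funext => w; rewrite big_enum/= -mulr_sumr.
Qed.

Lemma polynomial_traces L : is_polynomial X (traces L).
Proof.
elim: L => [|[q s] L IH].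
  rewrite (_ : traces [::] = monomial X [::]);
    first exact: is_polynomial_monomial.
  by apply/funext => w; rewrite /traces /monomial !big_nil.
rewrite (_ : traces _ = fun w => block_trace q s w * traces L w).
  by apply: polynomialM => //; exact: polynomial_block_trace.
by apply/funext => w; rewrite /traces big_cons.
Qed.

(** The derivative, in the direction of $Y_{i,j}$, of the rest of the product after that letter: the
    first summand contracts within the same word, the second with another trace. *)
Let wick_term u p q s L i j w : R[i] :=
  split_sum (fun a z b => ((z.1 == u) && (z.2 == q))%:R *
       (V u q p / n%:R)%:C * (path_mx a w j j * path_mx b w i i)) s * traces L
         w +
  path_mx s w j i * split_sum (fun L1 z' L2 => traces (L1 ++ L2) w *
      split_sum (fun a z b => ((z.1 == u) && (z.2 == q))%:R *
       (V u q p / n%:R)%:C * ((#|N z'.1|%:R)^-1 *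
       \sum_(k in N z'.1) path_mx a w k j * path_mx b w i k)) z'.2) L.

Let polynomial_wick_term u p q s L i j : is_polynomial X
  (wick_term u p q s L i j).
Proof.
apply: (polynomialD gX indX _ _).1; apply: polynomialM.
- apply: (polynomial_split_sum gX indX _ _).1 => a z b.
  apply: (polynomialZ gX indX _ _).1; apply: polynomialM;
    exact: polynomial_path.
- exact: polynomial_traces.
- exact: polynomial_path.
- apply: (polynomial_split_sum gX indX _ _).1 => L1 z' L2.
  apply: polynomialM; first exact: polynomial_traces.
  apply: (polynomial_split_sum gX indX _ _).1 => a z b.
  apply: (polynomialZ gX indX _ _).1; apply: (polynomialZ gX indX _ _).1.
  rewrite (_ : (fun w => _) =
    fun w => \sum_(k <- enum (N z'.1)) 1 * (path_mx a w k j * path_mx b w i k)).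
    apply: (polynomial_lin gX indX _ _ _).1 => k.
    apply: polynomialM; exact: polynomial_path.
  by apply/funext => w; rewrite big_enum; apply: eq_bigr => k _; rewrite mul1r.
Qed.

(** The sums over [i] and [j] are matrix products that insert [s] between [a] and [b]. Restricting
    them to blocks is harmless if these are the blocks where [s] and [a] end; otherwise everything
    vanishes. *)
Let sum_merged_path q' p q a s b w :
  \sum_(i in N q) \sum_(j in N p) path_mx s w j i *
    (\sum_(k in N q') path_mx a w k j * path_mx b w i k) =
  ((path_end q' a == p) && (path_end p s == q))%:R *
    \sum_(k in N q') path_mx (a ++ s ++ b) w k k.
Proof.
transitivity (\sum_(k in N q') \sum_(j in N p) path_mx a w k j *
    (\sum_(i in N q) path_mx s w j i * path_mx b w i k)).
  under eq_bigr do under eq_bigr do rewrite mulr_sumr.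
  rewrite exchange_big/=; under eq_bigr do rewrite exchange_big/=.
  rewrite exchange_big/=; apply: eq_bigr => k _; apply: eq_bigr => j _.
  by rewrite mulr_sumr; apply: eq_bigr => i _; rewrite mulrCA.
rewrite mulr_sumr; apply: eq_bigr => k kq'.
under eq_bigr => j jp do rewrite (sum_block_path q s w _ jp).
rewrite (sum_block_path p a w _ kq') -mulnb natrM -mulrA; congr (_ * _).
rewrite path_mx_cat mxE mulr_sumr; apply: eq_bigr => j _.
by rewrite path_mx_cat mxE mulrCA.
Qed.

(** In a split, the sum over [j] becomes a trace without its normalization, which produces [#|N p|].
    In a merger both sums are absorbed by the matrix product, and the factor $1/|N_q|$ of the first
    trace is left over. *)
Let sum_wick_term u p q s L w :
  (#|N q|%:R)^-1 * \sum_(i in N q) \sum_(j in N p) wick_term u p q s L i j w =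
  split_sum (fun a z b => ((z.1 == u) && (z.2 == q))%:R *
    (V u q p * (#|N p|%:R / n%:R))%:C * traces [:: (p, a), (q, b) & L] w) s +
  split_sum (fun L1 z' L2 => split_sum (fun a z b =>
    ([&& z.1 == u, z.2 == q, path_end z'.1 a == p & path_end p s == q])%:R *
    (V u q p / n%:R)%:C / #|N q|%:R * traces ((z'.1, a ++ s ++ b) :: L1 ++ L2)
      w) z'.2) L.
Proof.
have lin (f : 'I_n -> 'I_n -> R[i] -> R[i]) (T : Type)
  (F : 'I_n -> 'I_n -> seq T -> T -> seq T -> R[i]) (m : seq T) :
    (forall i j x y, f i j (x + y) = f i j x + f i j y) ->
      (forall i j, f i j 0 = 0) ->
    (#|N q|%:R)^-1 * \sum_(i in N q) \sum_(j in N p) f i j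
      (split_sum (F i j) m) =
    split_sum (fun a z b => (#|N q|%:R)^-1 *
      \sum_(i in N q) \sum_(j in N p) f i j (F i j a z b)) m.
  move=> fD f0; elim: m F => [|z m IH] F /=.
    by rewrite big1 ?mulr0// => i _; rewrite big1.
  rewrite -IH -mulrDr -big_split/=; congr (_ * _); apply: eq_bigr => i _.
  by rewrite -big_split/=; apply: eq_bigr => j _.
under eq_bigr do rewrite big_split/=; rewrite big_split mulrDr/=; congr (_ + _).
  rewrite (lin (fun _ _ x => x * traces L w)); last 2 first.
  - by move=> *; rewrite mulrDl.
  - by move=> *; rewrite mul0r.
  apply: eq_split_sum => a z b _; rewrite /traces !big_cons/= -/(traces L w).
  have -> : (V u q p * (#|N p|%:R / n%:R))%:C =
    (V u q p / n%:R)%:C * #|N p|%:R :> R[i].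
    by rewrite -[#|N p|%:R in RHS](rmorph_nat (@real_complex R)) -rmorphM/=
      mulrA mulrAC.
  set c := (V u q p / n%:R)%:C; set e := _%:R * c.
  rewrite /block_trace.
  transitivity ((#|N q|%:R)^-1 * (e * ((\sum_(j in N p) path_mx a w j j) *
    (\sum_(i in N q) path_mx b w i i)) * traces L w)).
    congr (_ * _); rewrite [(\sum_(j in N p) _) * _]mulrC mulr_suml mulr_sumr
      mulr_suml.
    apply: eq_bigr => i _; rewrite mulr_sumr mulr_sumr mulr_suml.
    by apply: eq_bigr => j _; rewrite [path_mx a w j j * _]mulrC.
  rewrite {}/e; move: (\sum_(j in N p) _) (\sum_(i in N q) _) (traces L w) =>
    S1 S2 S.
  have := cardN0 p; have := cardN0 q;
    move: (#|N p|%:R) (#|N q|%:R) => x y y0 x0.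
  by clearbody c; field; rewrite y0.
rewrite (lin (fun i j x => path_mx s w j i * x)); last 2 first.
- by move=> *; rewrite mulrDr.
- by move=> *; rewrite mulr0.
apply: eq_split_sum => L1 z' L2 _.
transitivity (split_sum (fun a z b => (#|N q|%:R)^-1 *
    \sum_(i in N q) \sum_(j in N p) path_mx s w j i * (traces (L1 ++ L2) w *
     (((z.1 == u) && (z.2 == q))%:R * (V u q p / n%:R)%:C * ((#|N z'.1|%:R)^-1 *
       \sum_(k in N z'.1) path_mx a w k j * path_mx b w i k)))) z'.2).
  rewrite (lin (fun i j x => path_mx s w j i * (traces (L1 ++ L2) w * x)))//.
  - by move=> *; rewrite !mulrDr.
  - by move=> *; rewrite !mulr0.
apply: eq_split_sum => a z b _.
set e := _%:R * (V u q p / n%:R)%:C;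
  rewrite /traces big_cons/= -/(traces (L1 ++ L2) w).
transitivity ((#|N q|%:R)^-1 * (traces (L1 ++ L2) w * e * (#|N z'.1|%:R)^-1 *
   (\sum_(i in N q) \sum_(j in N p) path_mx s w j i *
    (\sum_(k in N z'.1) path_mx a w k j * path_mx b w i k)))).
  congr (_ * _); rewrite mulr_sumr; apply: eq_bigr => i _.
  rewrite mulr_sumr; apply: eq_bigr => j _; rewrite !mulrA.
  by congr (_ * _); rewrite -!mulrA mulrC !mulrA.
have mb (b1 b2 : bool) : ((b1 && b2)%:R : R[i]) = b1%:R * b2%:R.
  by case: b1; rewrite ?mul1r ?mul0r.
rewrite sum_merged_path /block_trace/= {}/e !mb.
by move: (V u q p / n%:R)%:C (_^-1) (_^-1) => c x y; ring.
Qed.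

Lemma loop_equation u p q s L :
  trace_moment ((q, (u, p) :: s) :: L) =
  split_sum (fun a z b => ((z.1 == u) && (z.2 == q))%:R *
    (V u q p * (#|N p|%:R / n%:R))%:C * trace_moment [:: (p, a), (q, b) & L]) s
      +
  split_sum (fun L1 z' L2 => split_sum (fun a z b =>
    ([&& z.1 == u, z.2 == q, path_end z'.1 a == p & path_end p s == q])%:R *
    (V u q p / n%:R)%:C / #|N q|%:R *
    trace_moment ((z'.1, a ++ s ++ b) :: L1 ++ L2)) z'.2) L.
Proof.
pose F i j w := path_mx s w j i * traces L w.
have pF i j : is_polynomial X (F i j).
  by apply: polynomialM; [exact: polynomial_path|exact: polynomial_traces].
have pYF i j : is_polynomial X (fun w => Y u w i j * F i j w).
  by apply: polynomialM => //; exact: polynomial_entry.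
have lin (H : 'I_n -> 'I_n -> Omega -> R[i]) :
  (forall i j, is_polynomial X (H i j)) ->
    E (fun w => (#|N q|%:R)^-1 * \sum_(i in N q) \sum_(j in N p) H i j w) =
    (#|N q|%:R)^-1 * \sum_(i in N q) \sum_(j in N p) E (H i j).
  move=> pH.
  have h i := polynomial_lin gX indX (enum (N p)) (fun=> 1) (pH i).
  have h2 := polynomial_lin gX indX (enum (N q)) (fun=> (#|N q|%:R)^-1)
    (fun i => (h i).1).
  transitivity (E (fun w => \sum_(i <- enum (N q)) (#|N q|%:R)^-1 *
      \sum_(j <- enum (N p)) 1 * H i j w)).
    congr E; apply/funext => w; rewrite big_enum/= -mulr_sumr; congr (_ * _).
    apply: eq_bigr => i _; rewrite big_enum/=.
    by apply: eq_bigr => j _; rewrite mul1r.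
  rewrite h2.2 big_enum/= -mulr_sumr; congr (_ * _); apply: eq_bigr => i _.
  by rewrite (h i).2 big_enum/=; apply: eq_bigr => j _; rewrite mul1r.
transitivity (E (fun w => (#|N q|%:R)^-1 * \sum_(i in N q) \sum_(j in N p)
    (Y u w i j * F i j w))).
  congr E; apply/funext => w; rewrite /traces big_cons/= -/(traces L w).
  rewrite /block_trace -mulrA mulr_suml; congr (_ * _); apply: eq_bigr => i _.
  by rewrite path_mx_cons mulr_suml; apply: eq_bigr => j _; rewrite mulrA.
rewrite lin//.
transitivity (E (fun w => (#|N q|%:R)^-1 * \sum_(i in N q) \sum_(j in N p)
    wick_term u p q s L i j w)).
  rewrite lin; last exact: polynomial_wick_term.
  congr (_ * _); apply: eq_bigr => i iq; apply: eq_bigr => j jp.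
  have dF := is_derivationM (is_derivation_path u s j i iq jp)
    (is_derivation_traces u L iq jp).
  rewrite -(gaussian_integration_by_parts gX indX dF).
  by congr E; apply/funext => w; rewrite -entry_expand.
have pt c L' := polynomialZ gX indX c (polynomial_traces L').
have ps s' (c : seq (U * 'I_r) -> U * 'I_r -> seq (U * 'I_r) -> R[i])
    (L' : seq (U * 'I_r) -> U * 'I_r -> seq (U * 'I_r) -> seq
      ('I_r * seq (U * 'I_r))) :=
  polynomial_split_sum gX indX s' (fun a z b => (pt (c a z b) (L' a z b)).1).
transitivity (E (fun w => split_sum
  (fun a z b => ((z.1 == u) && (z.2 == q))%:R *
    (V u q p * (#|N p|%:R / n%:R))%:C * traces [:: (p, a), (q, b) & L] w) s +
  split_sum (fun L1 z' L2 => split_sum (fun a z b =>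
    ([&& z.1 == u, z.2 == q, path_end z'.1 a == p & path_end p s == q])%:R *
    (V u q p / n%:R)%:C / #|N q|%:R * traces ((z'.1, a ++ s ++ b) :: L1 ++ L2)
      w) z'.2) L)).
  by congr E; apply/funext => w; exact: sum_wick_term.
pose c1 (a : seq (U * 'I_r)) (z : U * 'I_r) (b : seq (U * 'I_r)) : R[i] :=
  ((z.1 == u) && (z.2 == q))%:R * (V u q p * (#|N p|%:R / n%:R))%:C.
pose c2 (z' : 'I_r * seq (U * 'I_r)) (a : seq (U * 'I_r)) (z : U * 'I_r)
    (b : seq (U * 'I_r)) : R[i] :=
  ([&& z.1 == u, z.2 == q, path_end z'.1 a == p & path_end p s == q])%:R *
    (V u q p / n%:R)%:C / #|N q|%:R.
have p1 := ps s c1 (fun a z b => [:: (p, a), (q, b) & L]).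
have p2 (L1 : seq ('I_r * seq (U * 'I_r))) z' L2 := ps z'.2 (c2 z')
  (fun a z b => (z'.1, a ++ s ++ b) :: L1 ++ L2).
have pS := polynomial_split_sum gX indX L (fun L1 z' L2 => (p2 L1 z' L2).1).
apply: eq_trans (polynomialD gX indX p1.1 pS.1).2 _; congr (_ + _).
  by rewrite p1.2; apply: eq_split_sum => a z b _; rewrite (pt _ _).2.
rewrite pS.2; apply: eq_split_sum => L1 z' L2 _.
by rewrite (p2 _ _ _).2; apply: eq_split_sum => a z b _; rewrite (pt _ _).2.
Qed.

End HGRM.

(** * Convergence *)

Section FockCoefficients.
Context (R : rcfType) (r : nat) (U : finType) (b : 'I_r -> 'I_r -> U -> R).
Hypothesis b0 : forall p q u, 0 <= b p q u.
Implicit Types (z p q : 'I_r) (u v : U) (l : seq ('I_r * U))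
  (s : seq (U * 'I_r)).

Definition top_index z l : 'I_r := head z (unzip1 l).

(* the coefficient at the tensor [(l, z)] of the vector obtained from [Omega_z] by
   the word [s], in which a letter [(u, p)] following the block [q] stands for
   wp_{q,p}(u) + wp_{p,q}(u)^*; the first letter is moved to the basis vector *)
Fixpoint fock_coef z s l : R :=
  if s is (u, p) :: s' then
    Num.sqrt (b p (top_index z l) u) * fock_coef z s' ((p, u) :: l) +
    (if l is (p0, u0) :: l' then
       ((u0 == u) && (top_index z l' == p))%:R * Num.sqrt (b p0 p u) *
         fock_coef z s' l'
     else 0)
  else (l == [::])%:R.

Definition limit_trace q s : R := fock_coef q s [::].

(* The word is cut at the letter that creates the first leg of the tensor. *)
Lemma fock_coef_cons z p u l s :
  fock_coef z s ((p, u) :: l) = split_sum (fun a y c =>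
    (y == (u, top_index z l))%:R * Num.sqrt (b p (top_index z l) u) *
    (limit_trace p a * fock_coef z c l)) s.
Proof.
have [m] := ubnP (size s);
  elim: m s z p u l => // m IH [|[v p1] s] z p u l // sm.
rewrite [LHS]/= [RHS]/=.
rewrite addrC; congr (_ + _); last first.
  rewrite (_ : limit_trace p [::] = 1)// mul1r xpair_eqE [u == v]eq_sym
    [_ == p1]eq_sym.
  by case: andP => [[/eqP-> /eqP->]|] //; rewrite !mul0r.
(* The other term puts a new leg [(p1, v)] in front. The word is cut at the creator of that leg and
   then at the creator of [(p, u)]; regrouping by the latter, the part before it reassembles into a
   [limit_trace] by the induction hypothesis for [t]. *)
rewrite IH//= (_ : top_index z _ = p)//.
have -> : split_sum (fun a y c => (y == (v, p))%:R * Num.sqrt (b p1 p v) *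
    (limit_trace p1 a * fock_coef z c ((p, u) :: l))) s =
  split_sum (fun a y d => split_sum (fun c y' e =>
   (y == (v, p))%:R * Num.sqrt (b p1 p v) * (limit_trace p1 a *
    ((y' == (u, top_index z l))%:R * Num.sqrt (b p (top_index z l) u) *
    (limit_trace p c * fock_coef z e l)))) d) s.
  apply: eq_split_sum => a y d sE; rewrite IH; last first.
    by move: sm; rewrite sE /= size_cat /= => ?; lia.
  rewrite -(split_sum_morph (f := fun x => _ * (limit_trace p1 a * x)))//.
    by rewrite !mulr0.
  by move=> x1 x2; rewrite !mulrDr.
rewrite split_sum_assoc.
rewrite (split_sum_morph (f := fun x => Num.sqrt (b p1 p v) * x)) ?mulr0//;
  last first.
  by move=> x1 x2; rewrite mulrDr.
apply: eq_split_sum => t y' e sE.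
rewrite [limit_trace p (_ :: _)]/limit_trace/= addr0 (IH t)/=; last first.
  by move: sm; rewrite sE /= size_cat /= => ?; lia.
rewrite (_ : top_index p [::] = p)//.
pose h x := (y' == (u, top_index z l))%:R * Num.sqrt (b p (top_index z l) u) *
  (Num.sqrt (b p1 p v) * x * fock_coef z e l).
have := split_sum_morph (f := h) (fun a y c => (y == (v, p))%:R *
  Num.sqrt (b p1 p v) * (limit_trace p1 a * fock_coef p c [::])) t.
rewrite /h => ->; [|by rewrite mulr0 mul0r mulr0|by move=> *;
  rewrite mulrDr mulrDl mulrDr].
rewrite (split_sum_morph (f := fun x => Num.sqrt (b p1 p v) * x)) ?mulr0//.
  by apply: eq_split_sum => a y c _; rewrite -/(limit_trace p c); ring.
by move=> x1 x2; rewrite mulrDr.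
Qed.

(** The first letter annihilates a leg that the letter at the cut creates; each contributes
    $\sqrt{b_{p,q}(u)}$. This is the loop equation without its merging terms. *)
Lemma limit_trace_cons q u p s :
  limit_trace q ((u, p) :: s) = split_sum (fun a y c =>
    (y == (u, q))%:R * b p q u * (limit_trace p a * limit_trace q c)) s.
Proof.
rewrite [LHS]/limit_trace/= addr0 fock_coef_cons.
rewrite (split_sum_morph (f := fun x => Num.sqrt (b p q u) * x)) ?mulr0//;
  last first.
  by move=> x1 x2; rewrite mulrDr.
apply: eq_split_sum => a y c _;
  rewrite -[b p q u in RHS](sqr_sqrtr (b0 p q u)) /top_index/=.
by rewrite -/(limit_trace q c) expr2; ring.
Qed.

End FockCoefficients.

Section Convergence.
Context (R : realType).

Lemma cvg_real_complex (T : Type) (F : set_system T) (FF : Filter F)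
  (f : T -> R) (a : R) :
  f x @[x --> F] --> a -> ((f x)%:C : R[i]^o) @[x --> F] --> (a%:C : R[i]^o).
Proof.
move=> fa; apply/cvgrPdist_lt => e e0.
have : 0 < complex.Re e by move: e0; rewrite ltcE/= => /andP[].
have eE : e = (complex.Re e)%:C.
  by case: e e0 => x y; rewrite ltcE/= => /andP[/eqP-> _].
move=> re0; move/cvgrPdist_lt : fa => /(_ _ re0); apply: filterS => x.
by rewrite [in X in _ -> X]eE -rmorphB/= normc_def/=
  expr0n addr0 sqrtr_sqr ltcR.
Qed.

Lemma cvg_split_sum (C : numFieldType) (S : Type) (T : Type) (F : set_system T)
  (FF : Filter F)
    (f : T -> seq S -> S -> seq S -> C^o) (g : seq S -> S -> seq S -> C^o)
      (s : seq S) :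
  (forall a x b, s = a ++ x :: b -> f t a x b @[t --> F] --> g a x b) ->
  split_sum (f t) s @[t --> F] --> split_sum g s.
Proof.
elim: s f g => [|x s IH] f g fg /=; first exact: cvg_cst.
apply: cvgD; first exact: fg.
by apply: IH => a y b sE; apply: fg; rewrite sE.
Qed.

Context (r : nat) (U : finType) (N : forall n : nat, 'I_r -> {set 'I_n})
  (hN : forall n, (r <= n)%N -> interval_partition (N n))
  (d : 'I_r -> R) (d0 : forall q, 0 <= d q)
  (hd : forall q, #|N n q|%:R / n%:R @[n --> \oo] --> d q)
  (V : U -> 'M[R]_r)
  (hVsym : forall u p q, V u p q = V u q p)
  (hVpos : forall u p q, 0 < V u p q)
  (dO : measure_display) (Omega : measurableType dO) (P : probability Omega R)
  (Y : U -> forall n : nat, Omega -> 'M[R[i]]_n)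
  (hY : forall n, (r <= n)%N -> HGRM P (N n) V (fun u => Y u n)).

Let b p q u := d p * V u p q.

Let b0 p q u : 0 <= b p q u. Proof. by rewrite mulr_ge0// ltW. Qed.

Local Notation G n L := (trace_moment (N n) P (fun u => Y u n) L).

Let merged_cvg0 (c : R) q :
  ((c / n%:R)%:C / #|N n q|%:R : R[i]^o) @[n --> \oo] --> (0 : R[i]^o).
Proof.
rewrite (_ : (fun n => _) = (fun n => (c / n%:R / #|N n q|%:R)%:C)); last first.
  by apply/funext => n; rewrite [RHS]rmorphM/= fmorphV rmorph_nat.
apply: cvg_real_complex; apply/norm_cvg0P.
apply: (@squeeze_cvgr _ _ _ _ (fun=> 0) (fun n => `|c| * n%:R^-1)).
- near=> n; rewrite normr_ge0/= !normrM [`|n%:R^-1|]ger0_norm ?invr_ge0//.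
  rewrite ler_piMr ?mulr_ge0 ?invr_ge0// ger0_norm ?invr_ge0//.
  (* The inverse of 0 is 0, so the bound by 1 also holds for those small [n] where a block may be
     empty. *)
  case: #|N n q| => [|k]; first by rewrite mulr0n invr0 ler01.
  by rewrite invf_le1 ?ler1n ?ltr0n.
- exact: cvg_cst.
- rewrite -[X in _ --> X](mulr0 `|c|); apply: cvgMr.
  by rewrite -cvg_shiftS; exact: cvg_harmonic.
Unshelve. all: by end_near. Qed.

Lemma trace_moment_cvg (L : seq ('I_r * seq (U * 'I_r))) :
  (G n L : R[i]^o) @[n --> \oo] -->
  (\prod_(z <- L) (limit_trace b z.1 z.2)%:C : R[i]^o).
Proof.
have near_r : \forall n \near \oo, (r <= n)%N by exact: nbhs_infty_ge.
(* Counting one extra unit per word makes the measure decrease also when an empty word is dropped. A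
   split lowers it by 1: it removes two letters and adds one word. *)
have [m] := ubnP (sumn [seq (size z.2).+1 | z <- L]).
elim: m L => // m IH [|[q [|[u p] s]] L] Lm.
- rewrite big_nil; apply: cvg_near_cst; near=> n.
  have rn : (r <= n)%N by near: n.
  by rewrite (trace_moment_nil (hY rn)).
- rewrite big_cons mul1r; apply: cvg_trans (IH L _); last by move: Lm => /=;
  lia.
  apply: near_eq_cvg; near=> n.
  have rn : (r <= n)%N by near: n.
  by rewrite (trace_moment_nil_cons _ _ (hN rn)).
(* A vanishing merging sum is added so that the limit has the shape of the loop equation and
   convergence can be checked term by term. *)
have -> : \prod_(z <- (q, (u, p) :: s) :: L) (limit_trace b z.1 z.2)%:C =
    split_sum (fun a z c => ((z.1 == u) && (z.2 == q))%:R * (b p q u)%:C *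
      \prod_(z <- [:: (p, a), (q, c) & L]) (limit_trace b z.1 z.2)%:C) s +
    split_sum (fun L1 z' L2 => split_sum (fun a z c =>
      ([&& z.1 == u, z.2 == q, path_end z'.1 a == p & path_end p s == q])%:R *
        0 *
      \prod_(z <- (z'.1, a ++ s ++ c) :: L1 ++ L2) (limit_trace b z.1 z.2)%:C)
        z'.2) L
    :> R[i]^o.
  rewrite [X in _ + X](eq_split_sum (G := fun _ _ _ => 0)); last first.
    move=> L1 z' L2 _; rewrite (eq_split_sum (G := fun _ _ _ => 0))
      ?split_sum0//.
    by move=> a z c _; rewrite mulr0 mul0r.
  rewrite split_sum0 addr0 big_cons/= (limit_trace_cons b0).
  rewrite (split_sum_morph
    (f := fun x => x%:C * \prod_(z <- L) (limit_trace b z.1 z.2)%:C));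
    last 2 first.
  - by rewrite mul0r.
  - by move=> x y; rewrite rmorphD mulrDl.
  apply: eq_split_sum => a [v q'] c _; rewrite !big_cons/= xpair_eqE.
  by rewrite !rmorphM/= rmorph_nat; ring.
apply: (@cvg_trans _ ((split_sum (fun a z c => ((z.1 == u) && (z.2 == q))%:R *
    (V u q p * (#|N n p|%:R / n%:R))%:C * G n [:: (p, a), (q, c) & L]) s +
  split_sum (fun L1 z' L2 => split_sum (fun a z c =>
    ([&& z.1 == u, z.2 == q, path_end z'.1 a == p & path_end p s == q])%:R *
    (V u q p / n%:R)%:C / #|N n q|%:R *
    G n ((z'.1, a ++ s ++ c) :: L1 ++ L2)) z'.2) L : R[i]^o) @[n --> \oo])).
  apply: near_eq_cvg; near=> n.
  have rn : (r <= n)%N by near: n.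
  by rewrite (loop_equation (hN rn) hVsym (hY rn)).
apply: cvgD.
  apply: cvg_split_sum => a z c sE; apply: cvgM; last first.
    by apply: IH; move: Lm; rewrite sE /= size_cat/=; lia.
  apply: cvgM; first exact: cvg_cst.
  apply: cvg_real_complex; rewrite /b mulrC hVsym; apply: cvgM; last exact: hd.
  exact: cvg_cst.
apply: cvg_split_sum => L1 [q' t] L2 LE; apply: cvg_split_sum => a z c tE.
apply: cvgM; last first.
  apply: IH; move: Lm tE; rewrite LE /= => + tE;
    rewrite tE !map_cat !sumn_cat/= !size_cat/=; lia.
rewrite (_ : (fun n => _) =
  (fun n => ([&& z.1 == u, z.2 == q,
  path_end q' a == p & path_end p s == q])%:R *
   ((V u q p / n%:R)%:C / #|N n q|%:R : R[i]^o))); last by apply/funext => n;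
     rewrite mulrA.
by apply: cvgM; [exact: cvg_cst|exact: merged_cvg0].
Unshelve. all: by end_near. Qed.

End Convergence.

(** * Operators on the Fock space *)

Section FockSpace.
Context (R : realType) (r : nat) (U : finType)
  (M : normedModType R[i]) (ip : {dot M for Num.conj})
  (hip : inner_product_norm ip)
  (e : fock_index r U -> M) (he : orthonormal_basis ip e)
  (b : 'I_r -> 'I_r -> U -> R)
  (wp : 'I_r -> 'I_r -> U -> {linear M -> M})
  (hwp : forall p q u, is_creation e (b p q u) p q u (wp p q u))
  (wp_adj : 'I_r -> 'I_r -> U -> M -> M)
  (hadj : forall p q u, is_adjoint ip (wp p q u) (wp_adj p q u)).
Implicit Types (p q z : 'I_r) (u : U) (x y : fock_index r U).

Let ipC v w : ip v w = Num.conj (ip w v).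
Proof. by rewrite (hermC ip) expr0 mul1r. Qed.

Let ipZl (c : R[i]) v w : ip (c *: v) w = c * ip v w.
Proof. exact: linearZl_LR. Qed.

Let ipZr (c : R[i]) v w : ip v (c *: w) = Num.conj c * ip v w.
Proof. exact: linearZr_LR. Qed.

Let ipDl v v' w : ip (v + v') w = ip v w + ip v' w.
Proof. exact: linearDl. Qed.

Let ip0r v : ip v 0 = 0.
Proof. exact: linear0r. Qed.

(** If [v] were nonzero, density would give a [w] in the span with $|v-w| < |v|$, whereas
    orthogonality gives $|v-w|^2 = |v|^2 + |w|^2$. *)
Lemma orthogonal_basis_eq0 (v : M) : (forall x, ip v (e x) = 0) -> v = 0.
Proof.
move=> hv; apply: contrapT => /eqP v0.
have nv : 0 < `|v| by rewrite normr_gt0.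
have : closure [set w : M | exists (s : seq (fock_index r U))
  (c : fock_index r U -> R[i]),
   w = \sum_(x <- s) c x *: e x] v by rewrite he.2.
move=> /(_ (ball v `|v|)) []; first exact: nbhsx_ballx.
move=> w [] [s [c wE]]; rewrite -ball_normE /= => vw.
have ipvw : ip v w = 0.
  rewrite wE linear_sumr big1// => x _; rewrite linearZr_LR/= hv.
  by rewrite mulr0.
have : ip (v - w) (v - w) = ip v v + ip w w by rewrite hnormBd.
rewrite !hip => E.
have : `|v - w| ^+ 2 < `|v| ^+ 2 by rewrite ltrXn2r.
by move=> /lt_geF; rewrite E lerDl exprn_ge0.
Qed.

(** The adjoint is given only through its pairing relation; pairing with every basis vector
    determines its values. *)
Lemma adjoint_basis p q u x : wp_adj p q u (e x) =
  if x is ((p0, u0) :: l, z) then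
    ([&& p0 == p, u0 == u & left_index (l, z) == q])%:R *
      (Num.sqrt (b p q u))%:C *: e (l, z)
  else 0.
Proof.
apply/eqP; rewrite -subr_eq0; apply/eqP; apply: orthogonal_basis_eq0 => y.
rewrite linearBl; apply/eqP; rewrite subr_eq0; apply/eqP.
transitivity (Num.conj (ip (e y) (wp_adj p q u (e x)))); first exact: ipC.
rewrite -hadj (hwp p q u).2.
have eC (B : bool) : Num.conj ((Num.sqrt (b p q u))%:C * B%:R) =
  (Num.sqrt (b p q u))%:C * B%:R.
  by rewrite rmorphM/= rmorph_nat; congr (_ * _); exact: conjc_real.
have -> : Num.conj (ip (if left_index y == q
      then (Num.sqrt (b p q u))%:C *: e (tensor_cons p u y) else 0) (e x)) =
    (Num.sqrt (b p q u))%:C *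
      ((left_index y == q) && (tensor_cons p u y == x))%:R.
  case: eqP => _ /=; last by rewrite linear0l rmorph0 mulr0.
  by rewrite ipZl he.1 eC.
case: x => -[|[p0 u0] l] z.
  by rewrite linear0l (_ : (tensor_cons p u y == _) = false) ?andbF ?mulr0.
transitivity (([&& p0 == p, u0 == u & left_index (l, z) == q])%:R *
  (Num.sqrt (b p q u))%:C * ((l, z) == y)%:R : R[i]); last first.
  by rewrite -he.1; exact: esym (ipZl _ _ _).
rewrite mulrAC mulrC; congr (_ * _); rewrite -natrM mulnb; congr (_%:R);
  congr nat_of_bool.
case: y => l' z'; rewrite /tensor_cons/= !xpair_eqE eqseq_cons xpair_eqE.
rewrite [p0 == p]eq_sym [u0 == u]eq_sym [l == l']eq_sym [z == z']eq_sym.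
have [->|] := eqVneq l' l; rewrite ?andbF//=; have [->|] := eqVneq z' z;
  rewrite ?andbF//=.
by rewrite !andbT andbC andbA.
Qed.

Section Symmetrized.
Let omega p q u v := wp p q u v + wp_adj p q u v.

(** Both halves of [omega] are moved to the basis vector, so [v] can be the image of any word and is
    never expanded in the basis. *)
Let omega_basis p q u v x :
  ip (omega p q u v) (e x) =
  (if x is ((p0, u0) :: l, z) then
     ([&& p0 == p, u0 == u & left_index (l, z) == q])%:R *
       (Num.sqrt (b p q u))%:C * ip v (e (l, z)) else 0) +
  (left_index x == q)%:R * (Num.sqrt (b p q u))%:C * ip v
    (e (tensor_cons p u x)).
Proof.
rewrite /omega ipDl hadj adjoint_basis; congr (_ + _).
  case: x => -[|[p0 u0] l] z; first by rewrite ip0r.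
  transitivity (Num.conj (([&& p0 == p, u0 == u & left_index (l, z) == q])%:R *
    (Num.sqrt (b p q u))%:C) * ip v (e (l, z))); first exact: ipZr.
  by rewrite rmorphM/= rmorph_nat; congr (_ * _ * _); exact: conjc_real.
transitivity (Num.conj (ip (e x) (wp_adj p q u v))); first exact: ipC.
rewrite -hadj (hwp p q u).2.
transitivity (ip v (if left_index x == q
  then (Num.sqrt (b p q u))%:C *: e (tensor_cons p u x) else 0)).
  exact: esym (ipC _ _).
case: eqP => _; last by rewrite ip0r !mul0r.
by rewrite ipZr mul1r; congr (_ * _); exact: conjc_real.
Qed.

(* the block reached from the block [a] by the symmetric block with indices [p, q] *)
Definition next_block (p q a : 'I_r) : option 'I_r :=
  if a == p then Some q else if a == q then Some p else None.

Fixpoint block_path (a : 'I_r) (t : seq ('I_r * 'I_r * U)) : option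
  (seq (U * 'I_r)) :=
  if t is (p, q, u) :: t' then
    if next_block p q a is Some c then omap (cons (u, c)) (block_path c t')
      else None
  else Some [::].

Lemma symmetrized_coef z (t : seq ('I_r * 'I_r * U)) l :
  ip (foldr (fun c f => symmetrized omega c.1.1 c.1.2 c.2 \o f) idfun t
    (e (vacuum U z)))
     (e (l, z)) =
  if block_path (top_index z l) t is Some s then (fock_coef b z s l)%:C else 0.
Proof.
elim: t l => [|[[p q] u] t IH] l /=.
  by rewrite he.1 /vacuum xpair_eqE eqxx andbT eq_sym rmorph_nat.
move: IH; set v := foldr _ _ _ _ => IH.
have IHe l' : ip v (e (l', z)) = if block_path (top_index z l') t is Some s
  then (fock_coef b z s l')%:C else 0 by exact: IH.
pose W c l' : R[i] := if block_path c t is Some s then (fock_coef b z s l')%:C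
  else 0.
pose A p' q' : R[i] := if l is (p0, u0) :: l' then
    ([&& p0 == p', u0 == u & top_index z l' == q'])%:R *
    (Num.sqrt (b p' q' u))%:C * W q' l' else 0.
pose B p' q' : R[i] := (top_index z l == q')%:R * (Num.sqrt (b p' q' u))%:C *
  W p' ((p', u) :: l).
have ob p' q' : ip (omega p' q' u v) (e (l, z)) = A p' q' + B p' q'.
  rewrite omega_basis IHe /A /B; congr (_ + _).
  case: l {A B} => [//|[p0 u0] l'] /=;
    rewrite IHe /left_index/= -/(top_index z l').
  by case: (eqVneq (top_index z l') q') => [->//|]; rewrite !andbF !mul0r.
set a := top_index z l.
have A0 p' q' : a != p' -> A p' q' = 0.
  by rewrite /A /a; case: (l) => [//|[p0 u0] l'] /= /negPf ->; rewrite !mul0r.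
have B0 p' q' : a != q' -> B p' q' = 0 by rewrite /B -/a => /negPf ->;
  rewrite !mul0r.
(* From block [a], the surviving contributions are the [wp] half of [omega a c] and the [wp_adj]
   half of [omega c a]. Both lead to the block [c], and together they form one step of
   [fock_coef]. *)
have AB c : A a c + B c a =
    if omap (cons (u, c)) (block_path c t) is Some s then
      (fock_coef b z s l)%:C else 0.
  rewrite /A /B -/a eqxx mul1r /W; case: (block_path c t) => [s|] /=;
    last first.
    by rewrite mulr0 addr0; case: (l) => [//|[p0 u0] l']; rewrite mulr0.
  rewrite -/a addrC rmorphD rmorphM/=; congr (_ + _).
  rewrite /a; case: (l) => [//|[p0 u0] l'] /=.
  by rewrite /top_index/= eqxx/= !rmorphM/= rmorph_nat.
rewrite /symmetrized /next_block; have [pq|pq] := eqVneq p q.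
  subst q; rewrite ob; have [ap|ap] := eqVneq a p; first by rewrite -ap;
    exact: AB.
  by rewrite A0// B0// addr0.
rewrite ipDl !ob; have [ap|ap] := eqVneq a p.
  subst p; rewrite [B a q]B0// [A q a]A0// addr0 add0r; exact: AB.
have [aq|aq] := eqVneq a q.
  by subst q; rewrite [A p a]A0// [B a p]B0// add0r addr0 addrC; exact: AB.
by rewrite !A0// !B0// !addr0.
Qed.

End Symmetrized.

End FockSpace.

(** * Products of symmetric blocks as paths of blocks *)

Section BlockProducts.
Context (R : realType) (r : nat) (U : finType) (n : nat)
  (N : 'I_r -> {set 'I_n}) (V : U -> 'M[R]_r)
  (dO : measure_display) (Omega : measurableType dO) (P : probability Omega R)
  (Y : U -> Omega -> 'M[R[i]]_n).
Hypotheses (hN : interval_partition N) (hV : forall u p q, V u p q = V u q p)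
  (hY : HGRM P N V Y).
Implicit Types (t : seq ('I_r * 'I_r * U)) (w : Omega).

Lemma block_mulmx p q (A : 'M[R[i]]_n) (i j : 'I_n) :
  (block_diag R N p *m A *m block_diag R N q) i j =
  ((i \in N p) && (j \in N q))%:R * A i j.
Proof.
rewrite mul_mx_diag !mxE (bigD1 i)//= big1 ?addr0; last first.
  by move=> k /negPf ki; rewrite !mxE eq_sym ki mul0r.
rewrite !mxE eqxx mulr1n.
by case: (i \in N p); case: (j \in N q); rewrite /= ?mulr1 ?mul1r ?mulr0 ?mul0r.
Qed.

Let in_block a p i : i \in N a -> (i \in N p) = (a == p).
Proof.
move=> ia; apply/idP/eqP => [ip|<-//]; exact: (block_eq hN ia ip).
Qed.

Lemma symmetric_block_entry a p q (A : 'M[R[i]]_n) (i j : 'I_n) : i \in N a ->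
  symmetric_block N p q A i j =
  if next_block p q a is Some c then (j \in N c)%:R * A i j else 0.
Proof.
move=> ia; rewrite /symmetric_block /next_block.
have [<-|pq] := eqVneq p q.
  by rewrite block_mulmx (in_block _ ia); case: (a == p); rewrite ?mul0r.
rewrite mxE !block_mulmx !(in_block _ ia).
have [ap|ap] := eqVneq a p; have [aq|aq] := eqVneq a q;
  rewrite /= ?mul0r ?addr0 ?add0r//.
by rewrite -ap aq eqxx in pq.
Qed.

Lemma prod_symmetric_block t a w (i l : 'I_n) : i \in N a ->
  (\prod_(c <- t) symmetric_block N c.1.1 c.1.2 (Y c.2 w)) i l =
  if block_path a t is Some s then path_mx N Y s w i l else 0.
Proof.
elim: t a i => [|[[p q] u] t IH] a i ia /=; first by rewrite big_nil.
rewrite big_cons; set B := \prod_(c <- t) _.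
transitivity (\sum_j symmetric_block N p q (Y u w) i j * B j l).
  by rewrite -[_ * B]/(_ *m B) mxE.
under eq_bigr do rewrite (symmetric_block_entry _ _ _ _ ia).
case: (next_block p q a) => [c|]; last by rewrite big1// => j _; rewrite mul0r.
transitivity (\sum_(j in N c) Y u w i j * B j l).
  rewrite [RHS]big_mkcond; apply: eq_bigr => j _.
  by case: (j \in N c); rewrite ?mul1r ?mul0r.
under eq_bigr => j jc do rewrite (IH _ _ jc).
case: (block_path c t) => [s|] /=; last by rewrite big1// => j _; rewrite mulr0.
by rewrite (path_mx_cons N Y u c s w i l).
Qed.

Lemma partial_trace_prod t q0 :
  partial_trace P N q0 (fun w => \prod_(c <- t) symmetric_block N c.1.1 c.1.2
    (Y c.2 w)) =
  if block_path q0 t is Some s then trace_moment N P Y [:: (q0, s)] else 0.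
Proof.
rewrite /partial_trace.
have gX := HGRM_gaussian hY; have indX := HGRM_independent hY.
rewrite (_ : (fun w => _) = (fun w => \sum_(j in N q0)
   if block_path q0 t is Some s then path_mx N Y s w j j else 0)); last first.
  by apply/funext => w; apply: eq_bigr => j jq; exact: prod_symmetric_block.
case: (block_path q0 t) => [s|]; last first.
  rewrite (_ : complex_expectation P _ = 0) ?mulr0//.
  have := (polynomialZ gX indX 0 (polynomial_traces hN hV hY [::])).2.
  rewrite mul0r => E0; rewrite -[RHS]E0; congr complex_expectation;
    apply/funext => w.
  by rewrite mul0r; exact: big1.
have pm j := polynomial_path hN hV hY s j j.
have h := polynomial_lin gX indX (enum (N q0)) (fun=> 1) pm.
rewrite /trace_moment (_ : traces N Y [:: (q0, s)] = fun w => (#|N q0|%:R)^-1 *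
   \sum_(j <- enum (N q0)) 1 * path_mx N Y s w j j).
  rewrite (polynomialZ gX indX _ h.1).2; congr (_ * complex_expectation _ _).
  by apply/funext => w; rewrite big_enum; apply: eq_bigr => j _; rewrite mul1r.
apply/funext => w; rewrite /traces big_seq1 /block_trace; congr (_ * _).
by rewrite big_enum; apply: eq_bigr => j _; rewrite mul1r.
Qed.

End BlockProducts.

Unset Implicit Arguments.

Theorem corollary6p2 (R : realType) (r : nat) (U : finType)
  (N : forall n : nat, 'I_r -> {set 'I_n})
  (hN : forall n, (r <= n)%N -> interval_partition (N n))
  (d : 'I_r -> R) (hd0 : forall q, 0 <= d q)
  (hd : forall q, #|N n q|%:R / n%:R @[n --> \oo] --> d q)
  (V : U -> 'M[R]_r)
  (hVsym : forall u p q, V u p q = V u q p)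
  (hVpos : forall u p q, 0 < V u p q)
  (dO : measure_display) (Omega : measurableType dO) (P : probability Omega R)
  (Y : U -> forall n : nat, Omega -> 'M[R[i]]_n)
  (hY : forall n, (r <= n)%N -> HGRM P (N n) V (fun u => Y u n))
  (M : completeNormedModType R[i]) (ip : {dot M for Num.conj})
  (hip : inner_product_norm ip)
  (e : fock_index r U -> M) (he : orthonormal_basis ip e)
  (wp : 'I_r -> 'I_r -> U -> {linear M -> M})
  (hwp : forall p q u, is_creation e (d p * V u p q) p q u (wp p q u))
  (wp_adj : 'I_r -> 'I_r -> U -> M -> M)
  (hadj : forall p q u, is_adjoint ip (wp p q u) (wp_adj p q u))
  (m : nat) (u : 'I_m -> U) (p q : 'I_m -> 'I_r) (q0 : 'I_r) :
  let T k n w := symmetric_block (N n) (p k) (q k) (Y (u k) n w) in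
  let omega p q u x := wp p q u x + wp_adj p q u x in
  partial_trace P (N n) q0 (fun w => \prod_(k < m) T k n w) @[n --> \oo] -->
  (vacuum_state ip e q0
     (\big[comp/idfun]_(k < m) symmetrized omega (p k) (q k) (u k)) : R[i]^o).
Proof.
move=> T omega.
pose t := [seq (p k, q k, u k) | k <- index_enum 'I_m].
pose b p q u := d p * V u p q.
have near_r : \forall n \near \oo, (r <= n)%N by exact: nbhs_infty_ge.
have -> : vacuum_state ip e q0
     (\big[comp/idfun]_(k < m) symmetrized omega (p k) (q k) (u k)) =
    if block_path q0 t is Some s then (limit_trace b q0 s)%:C else 0.
  rewrite -(symmetrized_coef hip he (b := b) hwp hadj q0 t [::]) /vacuum_state.
  congr (ip _ _); rewrite /t; elim: (index_enum _) => [|k s IH] /=.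
    by rewrite big_nil.
  by rewrite big_cons /= IH.
apply: (@cvg_trans _ ((if block_path q0 t is Some s
    then trace_moment (N n) P (fun u => Y u n) [:: (q0, s)] else 0 : R[i]^o)
      @[n --> \oo])).
  apply: near_eq_cvg; near=> n.
  have rn : (r <= n)%N by near: n.
  rewrite -(partial_trace_prod (hN n rn) hVsym (hY n rn)).
  by congr partial_trace; apply/funext => w; rewrite big_map.
(* Both sides are governed by the same path; if there is none, both vanish. A path that does not
   return to [q0] is covered by [trace_moment_cvg] like any other. *)
case: (block_path q0 t) => [s|]; last first.
  first [exact: (cvg_cst (0 : R[i]^o)) | exact: (@cvg_cst (R[i]^o) _ 0 \oo _) |
    exact: (@cvg_cst (R[i]^o))].
have := trace_moment_cvg hN hd0 hd hVsym hVpos hY (L := [:: (q0, s)]).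
by rewrite big_seq1.
Unshelve. all: by end_near. Qed.
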